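(* Let $T$ be an admissible set of $K_n$ and let $\langle T\rangle$ denote the two-sided ideal of $K_n$ generated by $T$. Then $\langle T\rangle\cap\mathcal{P}_n=T$ and $\langle T\rangle$ is a completely prime ideal (that is, $K_n/\langle T\rangle$ is a domain). Consequently, $\langle T\rangle$ is an $H$-prime ideal of $K_n$.
   Context: Let $k$ be a field of arbitrary characteristic and $n\ge 1$. All algebras are associative and unital. Let $p_1,\dots,p_n,q_1,\dots,q_n\in k^\times$ with $p_i\ne q_i$ for all $i$, and let $\Gamma=(\gamma_{i,j})\in M_n(k^\times)$ with $\gamma_{j,i}=\gamma_{i,j}^{-1}$ and $\gamma_{i,i}=1$ for all $i,j$. $K_n$ is the $k$-algebra generated by $x_1,y_1,\dots,x_n,y_n$ subject to the relations: $y_iy_j=\gamma_{i,j}y_jy_i$ for all $i,j$; $x_iy_j=p_j\gamma_{j,i}y_jx_i$ for $i<j$; $x_iy_j=q_j\gamma_{j,i}y_jx_i$ for $i>j$; $x_ix_j=q_ip_j^{-1}\gamma_{i,j}x_jx_i$ for $i<j$; $x_iy_i=q_iy_ix_i+\sum_{\ell<i}(q_\ell-p_\ell)y_\ell x_\ell$ for all $i$. Standing assumption: $p_iq_i^{-1}$ is not a root of unity for each $i\in\{1,\dots,n\}$. Group action: $H=\{(h_1,\dots,h_{2n})\in(k^\times)^{2n}\mid h_{2i-1}h_{2i}=h_{2j-1}h_{2j}\ \text{for all } i,j=1,\dots,n\}$ acts on $K_n$ by $k$-algebra automorphisms via $h(x_i)=h_{2i-1}x_i$, $h(y_i)=h_{2i}y_i$.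 An ideal $I$ is $H$-stable if $h(I)=I$ for all $h\in H$. A proper $H$-stable ideal $Q$ is $H$-prime if whenever $I,J$ are $H$-stable ideals with $IJ\subseteq Q$, either $I\subseteq Q$ or $J\subseteq Q$. For $i=1,\dots,n$ set $\Omega_i=\sum_{\ell\le i}(q_\ell-p_\ell)y_\ell x_\ell$, and set $\mathcal{P}_n=\{x_1,\dots,x_n,y_1,\dots,y_n,\Omega_1,\dots,\Omega_n\}$. A subset $T\subseteq\mathcal{P}_n$ is admissible if: (1) for $2\le i\le n$, ($x_i\in T$ or $y_i\in T$) if and only if ($\Omega_i\in T$ and $\Omega_{i-1}\in T$); and (2) ($x_1\in T$ or $y_1\in T$) if and only if $\Omega_1\in T$. *)

(* Defs.v *)
From HB Require Import structures.
From mathcomp Require Import all_boot all_algebra generic_quotient.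
From mathcomp Require Import boolp classical_sets.
From mathcomp Require Import finmap monalg.

Set Implicit Arguments.
Unset Strict Implicit.
Unset Printing Implicit Defensive.

Import GRing.Theory.
Local Open Scope ring_scope.
Local Open Scope quotient_scope.
Local Open Scope classical_set_scope.

(* Ideals are two-sided; closure under opposites follows from idealMl. *)
Record ideal (A : pzRingType) := Ideal {
  ideal_set :> set A;
  ideal0 : ideal_set 0;
  idealD : forall a b, ideal_set a -> ideal_set b -> ideal_set (a + b);
  idealMl : forall a b, ideal_set b -> ideal_set (a * b);
  idealMr : forall a b, ideal_set a -> ideal_set (a * b)
}.

Section Generated.
Variables (A : pzRingType) (S : set A).

Definition gen_set : set A :=
  [set a | forall I : ideal A, S `<=` I -> ideal_set I a].

Lemma gen_set0 : gen_set 0.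
Proof. by move=> I _; apply: ideal0. Qed.

Lemma gen_setD a b : gen_set a -> gen_set b -> gen_set (a + b).
Proof. by move=> Ia Ib I SI; apply: idealD; [apply: Ia | apply: Ib]. Qed.

Lemma gen_setMl a b : gen_set b -> gen_set (a * b).
Proof. by move=> Ib I SI; apply/idealMl/Ib. Qed.

Lemma gen_setMr a b : gen_set a -> gen_set (a * b).
Proof. by move=> Ia I SI; apply/idealMr/Ia. Qed.

Definition ideal_gen : ideal A := Ideal gen_set0 gen_setD gen_setMl gen_setMr.

Lemma sub_ideal_gen : S `<=` ideal_gen.
Proof. by move=> a Sa I; apply. Qed.

Lemma ideal_gen_sub (I : ideal A) : S `<=` I -> ideal_gen `<=` I.
Proof. by move=> SI a; apply. Qed.

End Generated.

Definition ideal_mul (A : pzRingType) (I J : ideal A) : ideal A :=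
  ideal_gen [set a * b | a in I & b in J].

(* Ideals may be improper, and the algebra structures of the library exclude *)
(* the zero ring, so a quotient is in general only a pzRing and a module.    *)

Section Quotient.
Variables (k : comNzRingType) (A : algType k) (I : ideal A).

Lemma idealN a : ideal_set I a -> ideal_set I (- a).
Proof. by move=> Ia; rewrite -mulN1r; apply: idealMl. Qed.

Lemma idealZ (c : k) a : ideal_set I a -> ideal_set I (c *: a).
Proof. by move=> Ia; rewrite -mulr_algl; apply: idealMl. Qed.

Definition ideal_eqv : rel A := fun a b => `[< ideal_set I (a - b) >].

Lemma ideal_eqv_is_equiv : equiv_class_of ideal_eqv.
Proof.
split=> [a | a b | b a c].
- by apply/asboolP; rewrite subrr; apply: ideal0.
- by apply/asboolP/asboolP => /idealN; rewrite opprB.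
- move=> /asboolP ab /asboolP bc; apply/asboolP.
  by rewrite -(subrKA b); apply: idealD.
Qed.

Canonical ideal_eqv_equiv := EquivRelPack ideal_eqv_is_equiv.
Canonical ideal_eqv_encModRel := defaultEncModRel ideal_eqv.

Definition quot := {eq_quot ideal_eqv}.
HB.instance Definition _ := Choice.on quot.
HB.instance Definition _ : EqQuotient A ideal_eqv quot := EqQuotient.on quot.

Lemma eq_piP (a b : A) : \pi_quot a = \pi_quot b <-> ideal_set I (a - b).
Proof.
split=> [/eqP|ab]; first by rewrite eqmodE => /asboolP.
by apply/eqP; rewrite eqmodE; apply/asboolP.
Qed.

(* The operations are locked only to keep unification from unfolding them. *)
Fact quot_key : unit. Proof. by []. Qed.
Definition quot_add : quot -> quot -> quot :=
  locked_with quot_key (fun u v => \pi_quot (repr u + repr v)).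
Definition quot_opp : quot -> quot :=
  locked_with quot_key (fun u => \pi_quot (- repr u)).
Definition quot_mul : quot -> quot -> quot :=
  locked_with quot_key (fun u v => \pi_quot (repr u * repr v)).
Definition quot_scale : k -> quot -> quot :=
  locked_with quot_key (fun c u => \pi_quot (c *: repr u)).

Lemma repr_pi (a : A) : ideal_set I (repr (\pi_quot a) - a).
Proof. by apply/eq_piP; rewrite reprK. Qed.

Lemma quot_addE a b : quot_add (\pi_quot a) (\pi_quot b) = \pi_quot (a + b).
Proof.
rewrite /quot_add locked_withE; apply/eq_piP; rewrite opprD addrACA.
by apply: idealD; apply: repr_pi.
Qed.

Lemma quot_oppE a : quot_opp (\pi_quot a) = \pi_quot (- a).
Proof.
rewrite /quot_opp locked_withE.
by apply/eq_piP; rewrite -opprD; apply/idealN/repr_pi.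
Qed.

Lemma quot_mulE a b : quot_mul (\pi_quot a) (\pi_quot b) = \pi_quot (a * b).
Proof.
rewrite /quot_mul locked_withE; apply/eq_piP.
rewrite -(subrKA (repr (\pi_quot a) * b)) -mulrBr -mulrBl.
by apply: idealD; [apply: idealMl | apply: idealMr]; apply: repr_pi.
Qed.

Lemma quot_scaleE c a : quot_scale c (\pi_quot a) = \pi_quot (c *: a).
Proof.
rewrite /quot_scale locked_withE.
by apply/eq_piP; rewrite -scalerBr; apply/idealZ/repr_pi.
Qed.

Let piP (P : quot -> Prop) : (forall a, P (\pi_quot a)) -> forall u, P u.
Proof. by move=> Ppi u; rewrite -[u]reprK. Qed.

Let quotE := (quot_addE, quot_oppE, quot_mulE, quot_scaleE).

Lemma quot_addA : associative quot_add.
Proof. by do 3!elim/piP=> ?; rewrite !quotE addrA. Qed.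
Lemma quot_addC : commutative quot_add.
Proof. by do 2!elim/piP=> ?; rewrite !quotE addrC. Qed.
Lemma quot_add0 : left_id (\pi_quot 0) quot_add.
Proof. by elim/piP=> ?; rewrite !quotE add0r. Qed.
Lemma quot_addN : left_inverse (\pi_quot 0) quot_opp quot_add.
Proof. by elim/piP=> ?; rewrite !quotE addNr. Qed.

HB.instance Definition _ :=
  GRing.isZmodule.Build quot quot_addA quot_addC quot_add0 quot_addN.

Lemma quot_mulA : associative quot_mul.
Proof. by do 3!elim/piP=> ?; rewrite !quotE mulrA. Qed.
Lemma quot_mul1r : left_id (\pi_quot 1) quot_mul.
Proof. by elim/piP=> ?; rewrite !quotE mul1r. Qed.
Lemma quot_mulr1 : right_id (\pi_quot 1) quot_mul.
Proof. by elim/piP=> ?; rewrite !quotE mulr1. Qed.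
Lemma quot_mulDl : left_distributive quot_mul +%R.
Proof.
rewrite /GRing.add /=.
by do 3!elim/piP=> ?; rewrite !quotE mulrDl.
Qed.
Lemma quot_mulDr : right_distributive quot_mul +%R.
Proof.
rewrite /GRing.add /=.
by do 3!elim/piP=> ?; rewrite !quotE mulrDr.
Qed.

HB.instance Definition _ := GRing.Zmodule_isPzRing.Build quot
  quot_mulA quot_mul1r quot_mulr1 quot_mulDl quot_mulDr.

Lemma quot_scaleA c d u : quot_scale c (quot_scale d u) = quot_scale (c * d) u.
Proof. by elim/piP: u => ?; rewrite !quotE scalerA. Qed.
Lemma quot_scale1 : left_id 1 quot_scale.
Proof. by elim/piP=> ?; rewrite !quotE scale1r. Qed.
Lemma quot_scaleDr : right_distributive quot_scale +%R.
Proof.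
rewrite /(+%R : quot -> quot -> quot) /=.
by move=> c; do 2!elim/piP=> ?; rewrite !quotE scalerDr.
Qed.
Lemma quot_scaleDl u : {morph quot_scale^~ u : c d / c + d}.
Proof.
move=> c d; rewrite /(+%R : quot -> quot -> quot) /=.
by elim/piP: u => ?; rewrite !quotE scalerDl.
Qed.

HB.instance Definition _ := GRing.Zmodule_isLmodule.Build k quot
  quot_scaleA quot_scale1 quot_scaleDr quot_scaleDl.

Definition quot_pi : A -> quot := \pi_quot.

Lemma quot_pi_zmod_morphism : zmod_morphism quot_pi.
Proof.
move=> a b; rewrite /GRing.add /GRing.opp /=.
by rewrite /quot_pi !quotE.
Qed.
Lemma quot_pi_monoid_morphism : monoid_morphism quot_pi.
Proof. by split=> // a b; rewrite /GRing.mul /= /quot_pi !quotE. Qed.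
Lemma quot_pi_scalable : scalable quot_pi.
Proof. by move=> c a; rewrite /GRing.scale /= /quot_pi !quotE. Qed.

HB.instance Definition _ :=
  GRing.isZmodMorphism.Build A quot quot_pi quot_pi_zmod_morphism.
HB.instance Definition _ :=
  GRing.isMonoidMorphism.Build A quot quot_pi quot_pi_monoid_morphism.
HB.instance Definition _ :=
  GRing.isScalable.Build k A quot *:%R quot_pi quot_pi_scalable.

Lemma quot_piP (P : quot -> Prop) : (forall a, P (quot_pi a)) -> forall u, P u.
Proof. exact: piP. Qed.

Lemma quot_pi_eq0 a : quot_pi a = 0 <-> ideal_set I a.
Proof. by rewrite -[a in ideal_set I a]subr0; apply: eq_piP. Qed.

Lemma quot_mul_scaleAl (c : k) (u v : quot) : c *: (u * v) = (c *: u) * v.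
Proof.
elim/quot_piP: u => a; elim/quot_piP: v => b.
by rewrite -!linearZ -!rmorphM -linearZ /= scalerAl.
Qed.
Lemma quot_mul_scaleAr (c : k) (u v : quot) : c *: (u * v) = u * (c *: v).
Proof.
elim/quot_piP: u => a; elim/quot_piP: v => b.
by rewrite -!linearZ -!rmorphM -linearZ /= scalerAr.
Qed.

End Quotient.

Section QuotientLift.
Variables (k : comNzRingType) (A : algType k) (I : ideal A).
Variables (B : algType k) (f : {lrmorphism A -> B}).
Hypothesis fI : forall a, ideal_set I a -> f a = 0.

Definition quot_lift of (forall a, ideal_set I a -> f a = 0) : quot I -> B :=
  fun u => f (repr u).

Lemma quot_liftE a : quot_lift fI (quot_pi I a) = f a.
Proof.
by apply/eqP; rewrite -subr_eq0 -raddfB /=; apply/eqP/fI/repr_pi.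
Qed.

Lemma quot_lift_zmod_morphism : zmod_morphism (quot_lift fI).
Proof.
elim/quot_piP=> a; elim/quot_piP=> b.
by rewrite -raddfB !quot_liftE raddfB.
Qed.
Lemma quot_lift_monoid_morphism : monoid_morphism (quot_lift fI).
Proof.
split; first by rewrite -(rmorph1 (quot_pi I)) quot_liftE rmorph1.
elim/quot_piP=> a; elim/quot_piP=> b.
by rewrite -rmorphM !quot_liftE rmorphM.
Qed.
Lemma quot_lift_scalable : scalable (quot_lift fI).
Proof.
by move=> c; elim/quot_piP=> a; rewrite -linearZ !quot_liftE linearZ.
Qed.

HB.instance Definition _ :=
  GRing.isZmodMorphism.Build (quot I) B (quot_lift fI) quot_lift_zmod_morphism.
HB.instance Definition _ :=
  GRing.isMonoidMorphism.Build (quot I) B (quot_lift fI)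
    quot_lift_monoid_morphism.
HB.instance Definition _ :=
  GRing.isScalable.Build k (quot I) B *:%R (quot_lift fI) quot_lift_scalable.

End QuotientLift.

(* The free algebra on G is the monoid algebra of the free monoid on G. *)
Section FreeAlgebra.
Variables (k : comNzRingType) (G : choiceType).

Definition free_alg := {malg k[{fmonom G}]}.
HB.instance Definition _ := GRing.Lalgebra.on free_alg.

Lemma free_alg_scalerAr (c : k) (a b : free_alg) : c *: (a * b) = a * (c *: b).
Proof.
apply/malgP=> m; rewrite mcoeffZ mcoeffMl.
rewrite (mcoeffMlw m (fsubset_refl (msupp a)) (msuppZ_le c b)) mulr_sumr.
apply: eq_bigr=> m1 _; rewrite mulr_sumr; apply: eq_bigr=> m2 _.
by rewrite mcoeffZ mulrnAr mulrCA.
Qed.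

HB.instance Definition _ :=
  GRing.Lalgebra_isAlgebra.Build k free_alg free_alg_scalerAr.

Definition free_gen (g : G) : free_alg := << fmu g >>.

Definition const_coef : free_alg -> k := mcoeff mone.
HB.instance Definition _ :=
  GRing.isZmodMorphism.Build free_alg k const_coef (mcoeff_is_additive mone).
HB.instance Definition _ := GRing.isMonoidMorphism.Build free_alg k const_coef
  (pair (@mcoeff1g_is_multiplicative _ k).2
        (@mcoeff1g_is_multiplicative _ k).1).

Lemma const_coef_gen g : const_coef (free_gen g) = 0.
Proof. by rewrite /const_coef mcoeffU -val_eqE fmuE /mone /= fmoneE. Qed.

End FreeAlgebra.

Section FreeLift.
Variables (k : comNzRingType) (G : choiceType) (B : algType k) (v : G -> B).

Definition free_word (m : {fmonom G}) : B := \prod_(g <- m) v g.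

Lemma free_word_mmorphism : mmorphism free_word.
Proof.
split=> [m1 m2|]; rewrite /free_word.
  by rewrite /mmul /= fmmulE big_cat.
by rewrite /mone /= fmoneE big_nil.
Qed.

HB.instance Definition _ :=
  isMultiplicative.Build {fmonom G} B free_word free_word_mmorphism.

Definition free_lift : free_alg k G -> B := mmap (in_alg B) free_word.

Lemma free_lift_zmod_morphism : zmod_morphism free_lift.
Proof. exact: mmap_is_additive. Qed.
Lemma free_lift_monoid_morphism : monoid_morphism free_lift.
Proof.
have comm_v (g : {malg k[{fmonom G}]}) m m' :
    GRing.comm (in_alg B g@_m) (free_word m').
  by rewrite /GRing.comm /= mulr_algl mulr_algr.
have [fM f1] := commr_mmap_is_multiplicative comm_v.
by split.
Qed.
Lemma free_lift_scalable : scalable free_lift.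
Proof. by move=> c a; rewrite /free_lift mmapZ /= mulr_algl. Qed.

HB.instance Definition _ :=
  GRing.isZmodMorphism.Build (free_alg k G) B free_lift free_lift_zmod_morphism.
HB.instance Definition _ :=
  GRing.isMonoidMorphism.Build (free_alg k G) B free_lift
    free_lift_monoid_morphism.
HB.instance Definition _ :=
  GRing.isScalable.Build k (free_alg k G) B *:%R free_lift free_lift_scalable.

Lemma free_lift_gen g : free_lift (free_gen k g) = v g.
Proof.
by rewrite /free_lift mmapU /= scale1r mul1r /free_word fmuE big_seq1.
Qed.

Lemma free_lift_unique (f : {lrmorphism free_alg k G -> B}) :
  (forall g, f (free_gen k g) = v g) -> f =1 free_lift.
Proof.
move=> fv a; rewrite [a in LHS]monalgE raddf_sum /free_lift mmapE.
apply: eq_bigr=> m _ /=.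
have -> : << a@_m *g m >> = a@_m *: << m >> :> free_alg k G.
  by apply/malgP=> w; rewrite mcoeffZ !mcoeffU mulrnAr mulr1.
rewrite linearZ /= mulr_algl; congr (_ *: _).
case: m=> s; elim: s=> [|g s IHs].
  rewrite /free_word big_nil -[RHS](rmorph1 f); congr (f _).
  by congr << _ >>; rewrite /mone /= fmoneE.
rewrite /free_word big_cons -fv -[X in _ * X]IHs -rmorphM; congr (f _).
by rewrite /GRing.mul /= fgmulUU mulr1 /mmul /= fmmulE fmuE.
Qed.

End FreeLift.

(* The indices 1, ..., n are represented by 'I_n, that is by 0, ..., n-1. *)

Section Kn.
Variables (k : fieldType) (n : nat).

(* inl i stands for x_i and inr i for y_i *)
Definition Kn_gens : choiceType := ('I_n + 'I_n)%type.

Local Notation fx i := (free_gen k (inl i : Kn_gens)).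
Local Notation fy i := (free_gen k (inr i : Kn_gens)).

Variables (p q : 'I_n -> k) (gamma : 'M[k]_n).

(* Each relation u = v is encoded by the element u - v of the free algebra *)
Inductive Kn_rels : set (free_alg k Kn_gens) :=
| Rel_yy (i j : 'I_n) :
    Kn_rels (fy i * fy j - gamma i j *: (fy j * fy i))
| Rel_xy_lt (i j : 'I_n) of (i < j)%N :
    Kn_rels (fx i * fy j - (p j * gamma j i) *: (fy j * fx i))
| Rel_xy_gt (i j : 'I_n) of (j < i)%N :
    Kn_rels (fx i * fy j - (q j * gamma j i) *: (fy j * fx i))
| Rel_xx (i j : 'I_n) of (i < j)%N :
    Kn_rels (fx i * fx j - (q i * (p j)^-1 * gamma i j) *: (fx j * fx i))
| Rel_xy_eq (i : 'I_n) :
    Kn_rels (fx i * fy i - (q i *: (fy i * fx i)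
               + \sum_(l < n | (l < i)%N) (q l - p l) *: (fy l * fx l))).

Definition Kn := quot (ideal_gen Kn_rels).
HB.instance Definition _ := GRing.PzRing.on Kn.
HB.instance Definition _ := GRing.Lmodule.on Kn.

Definition Kn_pi : free_alg k Kn_gens -> Kn := quot_pi (ideal_gen Kn_rels).
HB.instance Definition _ := GRing.RMorphism.on Kn_pi.
HB.instance Definition _ := GRing.Linear.on Kn_pi.

Lemma rels_kernel (B : pzRingType) (f : {rmorphism free_alg k Kn_gens -> B}) :
  (forall r, Kn_rels r -> f r = 0) ->
  forall a, ideal_set (ideal_gen Kn_rels) a -> f a = 0.
Proof.
move=> fR a; pose K := @Ideal _ [set a | f a = 0] (raddf0 f).
have KD b c : f b = 0 -> f c = 0 -> f (b + c) = 0.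
  by move=> fb fc; rewrite rmorphD /= fb fc addr0.
have Kl b c : f c = 0 -> f (b * c) = 0 by move=> fc; rewrite rmorphM /= fc mulr0.
have Kr b c : f b = 0 -> f (b * c) = 0 by move=> fb; rewrite rmorphM /= fb mul0r.
exact: (@ideal_gen_sub _ Kn_rels (K KD Kl Kr) fR).
Qed.

Lemma Kn_oner_neq0 : 1 != 0 :> Kn.
Proof.
rewrite -(rmorph1 Kn_pi); apply/eqP=> /quot_pi_eq0.
pose f : {rmorphism free_alg k Kn_gens -> k} := @const_coef k Kn_gens.
have fM g (a : free_alg k Kn_gens) : f (free_gen k g * a) = 0.
  by rewrite rmorphM /= const_coef_gen mul0r.
have fZ g (c : k) (a : free_alg k Kn_gens) : f (c *: (free_gen k g * a)) = 0.
  by rewrite -mulr_algl rmorphM (fM g) mulr0.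
have fB a b : f a = 0 -> f b = 0 -> f (a - b) = 0.
  by move=> fa fb; rewrite rmorphB /= fa fb subr0.
have f0 r : Kn_rels r -> f r = 0.
  case=> [i j|i j _|i j _|i j _|i]; apply: fB;
    rewrite ?fM ?fZ // rmorphD /= fZ add0r.
  by rewrite rmorph_sum big1 // => l _; apply: fZ.
move=> /(rels_kernel f0)/eqP.
by rewrite rmorph1 oner_eq0.
Qed.

HB.instance Definition _ := GRing.PzSemiRing_isNonZero.Build Kn Kn_oner_neq0.
HB.instance Definition _ := GRing.Lmodule_isLalgebra.Build k Kn
  (@quot_mul_scaleAl _ _ (ideal_gen Kn_rels)).
HB.instance Definition _ := GRing.Lalgebra_isAlgebra.Build k Kn
  (@quot_mul_scaleAr _ _ (ideal_gen Kn_rels)).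

Definition Kx i : Kn := Kn_pi (fx i).
Definition Ky i : Kn := Kn_pi (fy i).
Lemma Kn_rel u v : Kn_rels (u - v) -> Kn_pi u = Kn_pi v.
Proof. by move=> Ruv; apply/eq_piP; apply: sub_ideal_gen. Qed.

Let piZM (c : k) u v : Kn_pi (c *: (u * v)) = c *: (Kn_pi u * Kn_pi v).
Proof. by rewrite linearZ /= (rmorphM Kn_pi). Qed.

Lemma Kn_yy i j : Ky i * Ky j = gamma i j *: (Ky j * Ky i).
Proof. by rewrite -piZM -(rmorphM Kn_pi); apply/Kn_rel/Rel_yy. Qed.

Lemma Kn_xy_lt (i j : 'I_n) : (i < j)%N ->
  Kx i * Ky j = (p j * gamma j i) *: (Ky j * Kx i).
Proof.
by move=> ij; rewrite -piZM -(rmorphM Kn_pi); apply/Kn_rel/Rel_xy_lt.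
Qed.

Lemma Kn_xy_gt (i j : 'I_n) : (j < i)%N ->
  Kx i * Ky j = (q j * gamma j i) *: (Ky j * Kx i).
Proof.
by move=> ij; rewrite -piZM -(rmorphM Kn_pi); apply/Kn_rel/Rel_xy_gt.
Qed.

Lemma Kn_xx (i j : 'I_n) : (i < j)%N ->
  Kx i * Kx j = (q i * (p j)^-1 * gamma i j) *: (Kx j * Kx i).
Proof. by move=> ij; rewrite -piZM -(rmorphM Kn_pi); apply/Kn_rel/Rel_xx. Qed.

Lemma Kn_xy_eq (i : 'I_n) :
  Kx i * Ky i = q i *: (Ky i * Kx i)
                + \sum_(l < n | (l < i)%N) (q l - p l) *: (Ky l * Kx l).
Proof.
under eq_bigr do rewrite -piZM.
rewrite -piZM -(rmorphM Kn_pi) -(raddf_sum Kn_pi) -(raddfD Kn_pi).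
exact/Kn_rel/Rel_xy_eq.
Qed.

Definition KOmega (i : 'I_n) : Kn :=
  \sum_(l < n | (l <= i)%N) (q l - p l) *: (Ky l * Kx l).

Definition calP : set Kn := range Kx `|` range Ky `|` range KOmega.

(* The value 0 of the index is the paper's i = 1, and i = j.+1 means j = i-1. *)
Definition admissible (T : set Kn) : Prop :=
  [/\ T `<=` calP,
      forall i j : 'I_n, i = j.+1 :> nat ->
        (T (Kx i) \/ T (Ky i)) <-> (T (KOmega i) /\ T (KOmega j))
    & forall i : 'I_n, i = 0%N :> nat ->
        (T (Kx i) \/ T (Ky i)) <-> T (KOmega i)].

(* Hval (inl i) and Hval (inr i) are the coordinates h_{2i-1} and h_{2i} of  *)
(* the 2n-tuple h.                                                           *)
Record Hgroup := HGroup {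
  Hval :> Kn_gens -> k;
  Hval_neq0 : forall g, Hval g != 0;
  Hval_eq : forall i j, Hval (inl i) * Hval (inr i)
                         = Hval (inl j) * Hval (inr j)
}.

Definition free_Hact (h : Hgroup) : free_alg k Kn_gens -> Kn :=
  free_lift (fun g => h g *: Kn_pi (free_gen k g)).
HB.instance Definition _ h := GRing.RMorphism.on (free_Hact h).
HB.instance Definition _ h := GRing.Linear.on (free_Hact h).

Lemma free_Hact_rels h a :
  ideal_set (ideal_gen Kn_rels) a -> free_Hact h a = 0.
Proof.
move: a; apply: rels_kernel=> r Rr.
have actB u v : free_Hact h (u - v) = free_Hact h u - free_Hact h v.
  exact: raddfB.
have actZ c u : free_Hact h (c *: u) = c *: free_Hact h u by exact: linearZ.
have actM (g g' : Kn_gens) : free_Hact h (free_gen k g * free_gen k g')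
    = (h g * h g') *: Kn_pi (free_gen k g * free_gen k g').
  by rewrite !rmorphM /= /free_Hact !free_lift_gen -scalerAl -scalerAr scalerA.
have piB u v : Kn_pi (u - v) = Kn_pi u - Kn_pi v by exact: raddfB.
have piZ c u : Kn_pi (c *: u) = c *: Kn_pi u by exact: linearZ.
have [c E] : exists c : k, free_Hact h r = c *: Kn_pi r.
  have actR (g g' : Kn_gens) (c : k) :
      free_Hact h (free_gen k g * free_gen k g'
                  - c *: (free_gen k g' * free_gen k g))
      = (h g * h g') *: Kn_pi (free_gen k g * free_gen k g'
                               - c *: (free_gen k g' * free_gen k g)).
    rewrite actB piB actZ piZ !actM scalerBr !scalerA.
    by rewrite [h g' * _]mulrC [c * _]mulrC.
  case: Rr=> [i j|i j _|i j _|i j _|i]; try by eexists; apply: actR.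
  exists (h (inl i) * h (inr i)).
  rewrite actB piB actM scalerBr; congr (_ - _).
  rewrite raddfD /= [in RHS]raddfD /= actZ piZ actM scalerDr !scalerA.
  rewrite [h (inr i) * _]mulrC [q i * _]mulrC; congr (_ + _).
  rewrite [in LHS]raddf_sum [in RHS]raddf_sum scaler_sumr.
  apply: eq_bigr=> l _; rewrite /= actZ piZ actM !scalerA.
  by rewrite [h (inr l) * _]mulrC (Hval_eq h l i) mulrC.
have /(quot_pi_eq0 (ideal_gen Kn_rels)) : ideal_set (ideal_gen Kn_rels) r.
  exact: sub_ideal_gen.
by move=> r0; rewrite /= E /Kn_pi r0 scaler0.
Qed.

Definition Hact (h : Hgroup) : Kn -> Kn := quot_lift (free_Hact_rels h).
HB.instance Definition _ h := GRing.RMorphism.on (Hact h).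
HB.instance Definition _ h := GRing.Linear.on (Hact h).

Lemma Hact_x h i : Hact h (Kx i) = h (inl i) *: Kx i.
Proof. by rewrite /Hact /Kx quot_liftE /= /free_Hact free_lift_gen. Qed.

Lemma Hact_y h i : Hact h (Ky i) = h (inr i) *: Ky i.
Proof. by rewrite /Hact /Ky quot_liftE /= /free_Hact free_lift_gen. Qed.

Lemma Kn_morph_eq (B : algType k) (f f' : {lrmorphism Kn -> B}) :
  (forall i, f (Kx i) = f' (Kx i)) -> (forall i, f (Ky i) = f' (Ky i)) ->
  f =1 f'.
Proof.
move=> fx fy; elim/quot_piP=> a.
pose v g := f' (Kn_pi (free_gen k g)).
transitivity (free_lift v a); [|symmetry].
  apply: (free_lift_unique (f := f \o Kn_pi)) => -[i|i].
  - exact: fx.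
  - exact: fy.
exact: (free_lift_unique (f := f' \o Kn_pi)).
Qed.

Lemma Hinv_subproof (h : Hgroup) i j :
  (h (inl i))^-1 * (h (inr i))^-1 = (h (inl j))^-1 * (h (inr j))^-1.
Proof. by rewrite -!invfM (Hval_eq h i j). Qed.

Lemma Hinv_neq0 (h : Hgroup) g : (h g)^-1 != 0.
Proof. by rewrite invr_eq0 Hval_neq0. Qed.

Definition Hinv (h : Hgroup) : Hgroup :=
  HGroup (Hinv_neq0 h) (@Hinv_subproof h).

Lemma HactK h : cancel (Hact h) (Hact (Hinv h)).
Proof.
apply: (@Kn_morph_eq _ (Hact (Hinv h) \o Hact h) idfun) => i /=.
  by rewrite Hact_x linearZ /= Hact_x scalerA divff ?scale1r ?Hval_neq0.
by rewrite Hact_y linearZ /= Hact_y scalerA divff ?scale1r ?Hval_neq0.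
Qed.

Lemma HactVK h : cancel (Hact (Hinv h)) (Hact h).
Proof.
apply: (@Kn_morph_eq _ (Hact h \o Hact (Hinv h)) idfun) => i /=.
  by rewrite Hact_x linearZ /= Hact_x scalerA mulVf ?scale1r ?Hval_neq0.
by rewrite Hact_y linearZ /= Hact_y scalerA mulVf ?scale1r ?Hval_neq0.
Qed.

Lemma Hact_bij h : bijective (Hact h).
Proof. by exists (Hact (Hinv h)); [apply: HactK | apply: HactVK]. Qed.

Definition Hstable (I : ideal Kn) : Prop := forall h : Hgroup, Hact h @` I = I.

Definition Hprime (Q : ideal Kn) : Prop :=
  [/\ ideal_set Q <> setT, Hstable Q
    & forall I J : ideal Kn, Hstable I -> Hstable J ->
        ideal_mul I J `<=` Q -> I `<=` Q \/ J `<=` Q].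

End Kn.

Arguments Kn_pi {k n} p q gamma.
Arguments Kx {k n} p q gamma i.
Arguments Ky {k n} p q gamma i.
Arguments KOmega {k n} p q gamma i.
Arguments calP {k n} p q gamma.

Definition is_domain (R : pzRingType) : Prop :=
  1 != 0 :> R /\ forall a b : R, a * b = 0 -> a = 0 \/ b = 0.

Definition completely_prime (k : comNzRingType) (A : algType k) (I : ideal A) :=
  is_domain (quot I).

(* Main.v *)
From HB Require Import structures.
Require Import Defs.
From mathcomp Require Import all_boot all_order all_algebra ring zify.
From mathcomp Require Import boolp classical_sets.
From mathcomp Require Import finmap monalg.

Set Implicit Arguments.
Unset Strict Implicit.
Unset Printing Implicit Defensive.

Import Order.TTheory GRing.Theory Num.Theory.
Local Open Scope ring_scope.

(** The ideal generated by T is the kernel of a morphism from K_n to a quantum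
    torus, that is, to the group algebra of a free abelian group with its
    multiplication twisted by a bicharacter.

    Count indices from 0 and let Om j be the sum of the (q l - p l) y_l x_l over
    l < j, so that Om 0 = 0 and Om j.+1 is Omega_j.+1 of the usual numbering. In
    K_n the elements Om j commute with each other, Om j and y_i commute up to
    the factor q i if i < j and p i otherwise, and
    (q i - p i) y_i x_i = Om i.+1 - Om i. Hence, in a quantum torus on letters
    Y_i and W_j subject to the same commutation rules, the assignment
    y_i -> Y_i, x_i -> (q i - p i)^-1 Y_i^-1 (W_i.+1 - W_i) solves the defining
    relations of K_n and sends Om j to W_j, once W_0 is replaced by 0. To kill
    T, the letters Y_i with y_i in T and W_j with Om j in T are replaced by 0 as
    well. Admissibility makes this consistent: if x_i or y_i is in T, then Om i
    and Om i.+1 both vanish, and when y_i is killed but x_i is not, x_i may be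
    sent to Y_i^-1 W_i, since the relation between x_i and y_i has become
    trivial (torus_representation).

    The exponent group is totally ordered, so leading exponents of products add
    up and the torus is a domain (torus_domain); the kernel is therefore
    completely prime. It contains T. Conversely, modulo the ideal generated by
    T the algebra is spanned by the ordered monomials in the y_i^a x_i^b in
    which a = 0 if y_i is in T, b = 0 if x_i is in T, and a = 0 or b = 0 if
    Om i.+1 is in T (tower_full); the last rule is available because y_i x_i is
    then a multiple of Om i, which only involves smaller indices. The images of
    these monomials have distinct leading exponents (leads_mon, lexp_inj), so
    they are linearly independent (leads_free) and the kernel is no larger than
    the ideal (image_eq0).

    A member of P_n outside T has a nonzero image, whence the first assertion.
    Finally T consists of eigenvectors of H, so the ideal it generates is
    H-stable, and a completely prime H-stable ideal is H-prime. *)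

(** * Linear extension from a basis *)

Section LinearExtension.
Variables (k : comNzRingType) (E : choiceType) (V : lmodType k) (v : E -> V).

Definition lext (f : {malg k[E]}) : V := \sum_(e <- msupp f) f@_e *: v e.

Lemma lextEw (d : {fset E}) (f : {malg k[E]}) :
  (msupp f `<=` d)%fset -> lext f = \sum_(e <- d) f@_e *: v e.
Proof.
move=> fd; rewrite /lext (big_fset_incl _ fd) //= => e _ /mcoeff_outdom ->.
by rewrite scale0r.
Qed.

Lemma lext_is_linear : linear lext.
Proof.
move=> c f g; pose d := (msupp f `|` msupp g)%fset.
rewrite (@lextEw d f) ?fsubsetUl // (@lextEw d g) ?fsubsetUr //.
rewrite (@lextEw d); last first.
  apply: fsubset_trans (msuppD_le _ _) _; apply: fsetSU; exact: msuppZ_le.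
rewrite scaler_sumr -big_split /=; apply: eq_bigr => e _.
by rewrite mcoeffD mcoeffZ scalerDl scalerA.
Qed.

HB.instance Definition _ :=
  GRing.isLinear.Build k {malg k[E]} V *:%R lext lext_is_linear.

Lemma lextU e : lext << e >> = v e.
Proof.
by rewrite (@lextEw [fset e]%fset) ?msuppU_le // big_seq_fset1 mcoeffUU scale1r.
Qed.

End LinearExtension.

Lemma malg_span (k : comNzRingType) (E : choiceType) (f : {malg k[E]}) :
  f = \sum_(e <- msupp f) f@_e *: << e >>.
Proof.
rewrite [LHS]monalgE; apply: eq_bigr => e _; apply/malgP => e'.
by rewrite mcoeffZ !mcoeffU mulrnAr mulr1.
Qed.

Lemma malg_linear_ind (k : comNzRingType) (E : choiceType)
    (P : {malg k[E]} -> Prop) :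
  P 0 -> (forall f g, P f -> P g -> P (f + g)) ->
  (forall c e, P (c *: << e >>)) -> forall f, P f.
Proof.
by move=> P0 PD PU f; rewrite [f]malg_span; elim/big_ind: _ => // e _; apply: PU.
Qed.

(** * Twisted group algebras *)

(** The data of a twisted group algebra, where X^g X^h is s g h X^(g + h). *)
Record bichar (k : fieldType) (G : zmodType) := Bichar {
  bichar_val :> G -> G -> k;
  bicharDl : forall a b c,
    bichar_val (a + b) c = bichar_val a c * bichar_val b c;
  bicharDr : forall a b c,
    bichar_val a (b + c) = bichar_val a b * bichar_val a c;
  bichar_neq0 : forall a b, bichar_val a b != 0
}.

Section TwistedGroupAlgebra.
Variables (k : fieldType) (G : zmodType) (s : bichar k G).

Lemma bichar0l a : s 0 a = 1.
Proof.
have := bicharDl s 0 0 a; rewrite addr0 => /eqP.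
by rewrite -[X in X == _]mulr1 (inj_eq (mulfI (bichar_neq0 s 0 a))) => /eqP.
Qed.

Lemma bichar0r a : s a 0 = 1.
Proof.
have := bicharDr s a 0 0; rewrite addr0 => /eqP.
by rewrite -[X in X == _]mulr1 (inj_eq (mulfI (bichar_neq0 s a 0))) => /eqP.
Qed.

Lemma bicharNl a b : s (- a) b = (s a b)^-1.
Proof.
apply: (mulfI (bichar_neq0 s a b)).
by rewrite -bicharDl subrr bichar0l divff ?bichar_neq0.
Qed.

Lemma bicharNr a b : s a (- b) = (s a b)^-1.
Proof.
apply: (mulfI (bichar_neq0 s a b)).
by rewrite -bicharDr subrr bichar0r divff ?bichar_neq0.
Qed.

(** The bicharacter is a phantom argument: it lets the ring structure depend on
    it while the underlying module does not. *)
Definition torus_of of bichar k G : Type := {malg k[G]}.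
Local Notation torus := (torus_of s).
HB.instance Definition _ := GRing.Lmodule.on torus.

Definition tmon (g : G) : torus := << g >>.

Definition torus_mul (a b : torus) : torus :=
  lext (fun g => lext (fun h => s g h *: tmon (g + h)) b) a.

Lemma torus_mulDl : left_distributive torus_mul +%R.
Proof. by move=> a b c; rewrite /torus_mul linearD. Qed.

Lemma torus_mulDr : right_distributive torus_mul +%R.
Proof.
move=> a b c; rewrite /torus_mul /lext -big_split; apply: eq_bigr => g _ /=.
by rewrite -scalerDr; congr (_ *: _); apply: (linearD (lext _)).
Qed.

Lemma torus_mulZl c a b : torus_mul (c *: a) b = c *: torus_mul a b.
Proof. by rewrite /torus_mul linearZ. Qed.

Lemma torus_mulZr c a b : torus_mul a (c *: b) = c *: torus_mul a b.
Proof.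
rewrite /torus_mul /lext scaler_sumr; apply: eq_bigr => g _ /=.
by rewrite scalerA mulrC -scalerA; congr (_ *: _); apply: (linearZ_LR (lext _)).
Qed.

Lemma torus_mulUU g h : torus_mul (tmon g) (tmon h) = s g h *: tmon (g + h).
Proof. by rewrite /torus_mul !lextU. Qed.

Lemma torus_mul0 a : torus_mul a 0 = 0.
Proof. by rewrite -(scale0r (0 : torus)) torus_mulZr !scale0r. Qed.

Lemma torus_mul0l a : torus_mul 0 a = 0.
Proof. by rewrite -(scale0r (0 : torus)) torus_mulZl !scale0r. Qed.

Lemma torus_mulA : associative torus_mul.
Proof.
move=> a b c; elim/malg_linear_ind: a => [|a a' IH IH'|x g].
- by rewrite !torus_mul0l.
- by rewrite !torus_mulDl IH IH'.
rewrite !torus_mulZl; congr (_ *: _); elim/malg_linear_ind: b => [|b b' IH IH'|y h].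
- by rewrite !(torus_mul0, torus_mul0l).
- by rewrite !(torus_mulDl, torus_mulDr) IH IH'.
rewrite !(torus_mulZl, torus_mulZr); congr (_ *: _).
elim/malg_linear_ind: c => [|c c' IH IH'|z l].
- by rewrite !torus_mul0.
- by rewrite !torus_mulDr IH IH'.
rewrite !torus_mulZr !torus_mulUU torus_mulZl torus_mulZr !torus_mulUU !scalerA.
by rewrite bicharDl bicharDr addrA; congr (_ *: _); ring.
Qed.

Lemma torus_mul1 : right_id (tmon 0) torus_mul.
Proof.
elim/malg_linear_ind => [|a a' IH IH'|x g]; first by rewrite torus_mul0l.
  by rewrite torus_mulDl IH IH'.
by rewrite torus_mulZl torus_mulUU bichar0r scale1r addr0.
Qed.

Lemma torus_1mul : left_id (tmon 0) torus_mul.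
Proof.
elim/malg_linear_ind => [|a a' IH IH'|x g]; first by rewrite torus_mul0.
  by rewrite torus_mulDr IH IH'.
by rewrite torus_mulZr torus_mulUU bichar0l scale1r add0r.
Qed.

Lemma tmon_neq0 g : tmon g != 0.
Proof.
apply/eqP => /malgP/(_ g); rewrite mcoeffUU mcoeff0; exact/eqP/oner_neq0.
Qed.

HB.instance Definition _ := GRing.Zmodule_isNzRing.Build torus
  torus_mulA torus_1mul torus_mul1 torus_mulDl torus_mulDr (tmon_neq0 0).

Lemma torus_scalerAl (c : k) (a b : torus) : c *: (a * b) = (c *: a) * b.
Proof. by rewrite [RHS]torus_mulZl. Qed.
HB.instance Definition _ := GRing.Lmodule_isLalgebra.Build k torus torus_scalerAl.

Lemma torus_scalerAr (c : k) (a b : torus) : c *: (a * b) = a * (c *: b).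
Proof. by rewrite [RHS]torus_mulZr. Qed.
HB.instance Definition _ := GRing.Lalgebra_isAlgebra.Build k torus torus_scalerAr.

Lemma tmonM g h : tmon g * tmon h = s g h *: tmon (g + h).
Proof. exact: torus_mulUU. Qed.

Lemma tmonC g h : tmon g * tmon h = (s g h / s h g) *: (tmon h * tmon g).
Proof. by rewrite !tmonM scalerA divfK ?bichar_neq0 // addrC. Qed.

(** ** Leading monomials *)

(** The set pos is the positive cone of a total order on the group G. *)
Variable pos : G -> Prop.
Hypothesis pos0 : ~ pos 0.
Hypothesis posD : forall g h, pos g -> pos h -> pos (g + h).
Hypothesis pos_total : forall g, [\/ g = 0, pos g | pos (- g)].

Definition leads (a : torus) (g : G) : Prop :=
  a@_g != 0 /\ forall h, a@_h != 0 -> h = g \/ pos (g - h).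

Lemma leads_neq0 a g : leads a g -> a <> 0.
Proof. by case=> ag _ a0; move: ag; rewrite a0 mcoeff0 eqxx. Qed.

Lemma pos_max (T : eqType) (w : T -> G) (r : seq T) : r != [::] ->
  exists2 t, t \in r & forall u, u \in r -> w u = w t \/ pos (w t - w u).
Proof.
elim: r => // t r IH _; have [r0|/IH[u ur um]] := eqVneq r [::].
  by exists t; rewrite r0 ?mem_head // => u; rewrite inE => /eqP->; left.
case: (pos_total (w t - w u)) => [/eqP|tu|ut].
- rewrite subr_eq0 => /eqP tu; exists u; rewrite ?inE ?ur ?orbT // => x.
  by rewrite inE => /orP[/eqP->|/um //]; left.
- exists t; rewrite ?mem_head // => x.
  rewrite inE => /orP[/eqP->|/um[->|ux]]; [by left|by right|right].
  by rewrite -(subrKA (w u)); apply: posD.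
- exists u; rewrite ?inE ?ur ?orbT // => x.
  by rewrite inE => /orP[/eqP->|/um //]; right; rewrite -opprB.
Qed.

Lemma leads_exists a : a <> 0 -> exists g, leads a g.
Proof.
move=> a0; have : enum_fset (msupp a) != [::].
  apply/eqP => e0; apply: a0; apply/malgP => g; rewrite mcoeff0 mcoeff_outdom //.
  by apply/negP => ga; have : g \in enum_fset (msupp a) by []; rewrite e0.
case/(pos_max id) => g ga gm; exists g; split; first by rewrite mcoeff_neq0.
by move=> h; rewrite mcoeff_neq0 => /gm.
Qed.

Lemma torus_mulE (a b : torus) : a * b =
  \sum_(g <- msupp a) \sum_(h <- msupp b) (a@_g * b@_h * s g h) *: tmon (g + h).
Proof.
apply: eq_bigr => g _; rewrite scaler_sumr; apply: eq_bigr => h _.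
by rewrite !scalerA.
Qed.

Lemma mcoeff_sum (I : Type) (r : seq I) (F : I -> torus) g :
  (\sum_(i <- r) F i)@_g = \sum_(i <- r) (F i)@_g.
Proof. exact: (raddf_sum (mcoeff g)). Qed.

Lemma mcoeffM_torus (a b : torus) l : (a * b)@_l =
  \sum_(g <- msupp a) \sum_(h <- msupp b) (a@_g * b@_h * s g h) *+ (g + h == l).
Proof.
rewrite torus_mulE mcoeff_sum; apply: eq_bigr => g _.
rewrite mcoeff_sum; apply: eq_bigr => h _.
by rewrite mcoeffZ mcoeffU mulrnAr mulr1.
Qed.

(** A sum of two exponents can equal g + h only if both are maximal, so the
    coefficient at g + h is a single product, times a value of the
    bicharacter; nothing can cancel it. *)
Lemma leadsM a b g h : leads a g -> leads b h -> leads (a * b) (g + h).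
Proof.
move=> [ag am] [bh bm]; split.
  rewrite mcoeffM_torus (bigD1_seq g) ?fset_uniq -?mcoeff_neq0 //=.
  rewrite (bigD1_seq h) ?fset_uniq -?mcoeff_neq0 //= eqxx mulr1n.
  rewrite [X in _ + X + _]big1 ?addr0; last first.
    by move=> h' h'h; rewrite (inj_eq (addrI g)) (negPf h'h).
  rewrite [X in _ + X]big1_seq ?addr0; first by rewrite !mulf_neq0 ?bichar_neq0.
  move=> g' /andP[g'g g'a]; rewrite big1_seq // => h' /= h'b.
  case: eqP => // E; case: pos0.
  have /am[g'E|gp] : a@_g' != 0 by rewrite mcoeff_neq0.
    by rewrite g'E eqxx in g'g.
  have /bm[h'E|hp] : b@_h' != 0 by rewrite mcoeff_neq0.
    by case/eqP: g'g; apply: (addIr h); rewrite -E h'E.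
  by have := posD gp hp; rewrite addrACA -opprD E subrr.
move=> l; rewrite mcoeffM_torus => nz.
have [g' g'a [h' h'b E]] : exists2 g', g' \in msupp a &
    exists2 h', h' \in msupp b & g' + h' = l.
  apply: contrapT => none; case/eqP: nz.
  rewrite big1_seq // => g' /= g'a; rewrite big1_seq // => h' /= h'b.
  by case: eqP => // E; case: none; exists g' => //; exists h'.
have /am[g'E|gp] : a@_g' != 0 by rewrite mcoeff_neq0.
  have /bm[h'E|hp] : b@_h' != 0 by rewrite mcoeff_neq0.
    by left; rewrite -E g'E h'E.
  by right; rewrite -E g'E opprD addrACA subrr add0r.
right; rewrite -E opprD addrACA.
have /bm[->|hp] : b@_h' != 0 by rewrite mcoeff_neq0.
  by rewrite subrr addr0.
exact: posD.
Qed.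

Lemma torus_domain (a b : torus) : a * b = 0 -> a = 0 \/ b = 0.
Proof.
move=> ab0; have [->|/leads_exists[g ag]] := pselect (a = 0); first by left.
have [->|/leads_exists[h bh]] := pselect (b = 0); first by right.
by case: (leads_neq0 (leadsM ag bh)).
Qed.

Lemma leadsZ c a g : c != 0 -> leads a g -> leads (c *: a) g.
Proof.
move=> c0 [ag am]; split; first by rewrite mcoeffZ mulf_neq0.
by move=> h; rewrite mcoeffZ mulf_eq0 (negPf c0) => /am.
Qed.

Lemma leads_tmon g : leads (tmon g) g.
Proof.
split=> [|h]; first by rewrite mcoeffUU oner_neq0.
rewrite mcoeffU; have [->|_] := eqVneq g h; first by left.
by rewrite eqxx.
Qed.

Lemma leadsX a g m : leads a g -> leads (a ^+ m) (g *+ m).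
Proof.
move=> ag; elim: m => [|m IH]; first exact: leads_tmon.
by rewrite exprS mulrS; apply: leadsM.
Qed.

Lemma leads_add_lower c d g h : pos (g - h) -> c != 0 ->
  leads (c *: tmon g + d *: tmon h) g.
Proof.
move=> gh c0; have hg : h != g.
  by apply/eqP => E; case: pos0; rewrite E subrr in gh.
split=> [|l]; rewrite mcoeffD !mcoeffZ !mcoeffU.
  by rewrite eqxx (negPf hg) mulr0 addr0 mulr1.
have [<-|_] := eqVneq g l; first by left.
have [<-|_] := eqVneq h l; first by right.
by rewrite !mulr0 addr0 eqxx.
Qed.

(** A linear combination of elements with distinct leading exponents cannot
    vanish: the largest leading exponent occurs in one term only. *)
Lemma leads_free (E : choiceType) (v : E -> torus) (w : E -> G)
    (f : {malg k[E]}) :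
  (forall e, e \in msupp f -> leads (v e) (w e)) ->
  {in msupp f &, injective w} -> lext v f = 0 -> f = 0.
Proof.
move=> vw w_inj f0; apply: contrapT => fn0.
have : enum_fset (msupp f) != [::].
  apply/eqP => e0; apply: fn0; apply/malgP => g; rewrite mcoeff0 mcoeff_outdom //.
  by apply/negP => ga; have : g \in enum_fset (msupp f) by []; rewrite e0.
case/(pos_max w) => e ef em.
have := congr1 (mcoeff (w e)) f0; rewrite mcoeff0 mcoeff_sum.
rewrite (bigD1_seq e) ?fset_uniq //= [X in _ + X]big1_seq ?addr0 => [|e' /andP[e'e e'f]].
  move/eqP; rewrite mcoeffZ mulf_eq0 mcoeff_eq0 ef /=.
  by have [/negPf->] := vw e ef.
rewrite mcoeffZ; have [_ vm] := vw e' e'f.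
have [->|/vm] := eqVneq ((v e')@_(w e)) 0; first by rewrite mulr0.
case=> [/w_inj E'|p1]; first by rewrite E' ?eqxx // in e'e.
case: (em e' e'f) => [/w_inj E'|p2]; first by rewrite E' ?eqxx // in e'e.
by case: pos0; have := posD p1 p2; rewrite -opprB addNr.
Qed.

End TwistedGroupAlgebra.


(** * Exponents *)

Section Characters.
Variable k : fieldType.

(** Integer polynomials serve as the free abelian group on the letters X^i,
    ordered by the sign of the leading coefficient; zchar f is the character of
    this group that extends f. *)
Definition zchar (f : nat -> k) (a : {poly int}) : k :=
  \prod_(i < size a) f i ^ a`_i.

Lemma zcharEw f N (a : {poly int}) : (size a <= N)%N ->
  zchar f a = \prod_(i < N) f i ^ a`_i.
Proof.
move=> aN; rewrite /zchar (big_ord_widen N (fun i => f i ^ a`_i)) //.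
rewrite big_mkcond; apply: eq_bigr => i _; case: ltnP => // ai.
by rewrite nth_default // expr0z.
Qed.

Lemma zchar_neq0 f a : (forall i, f i != 0) -> zchar f a != 0.
Proof. by move=> f0; apply/prodf_neq0 => i _; rewrite expfz_neq0. Qed.

Lemma zcharD f a b : (forall i, f i != 0) ->
  zchar f (a + b) = zchar f a * zchar f b.
Proof.
move=> f0; pose N := maxn (size a) (size b).
rewrite !(@zcharEw _ N) ?leq_maxl ?leq_maxr ?size_polyD // -big_split.
by apply: eq_bigr => i _; rewrite coefD expfzDr.
Qed.

Lemma zchar_mul f g a : zchar (fun i => f i * g i) a = zchar f a * zchar g a.
Proof.
by rewrite /zchar -big_split; apply: eq_bigr => i _; rewrite expfzMl.
Qed.

Lemma zcharX f i : zchar f 'X^i = f i.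
Proof.
rewrite /zchar size_polyXn big_ord_recr big1 /= => [|j _].
  by rewrite mul1r coefXn eqxx expr1z.
by rewrite coefXn ltn_eqF // expr0z.
Qed.

End Characters.

(** The exponent group: the first component records the exponents of the
    letters Y_i, the second those of the letters W_j. *)
Definition exps : zmodType := ({poly int} * {poly int})%type.

Section ExponentBichar.
Variables (k : fieldType) (MY MW : nat -> nat -> k).
Hypothesis MY0 : forall i j, MY i j != 0.
Hypothesis MW0 : forall i j, MW i j != 0.

Definition zbichar (M : nat -> nat -> k) (a b : {poly int}) : k :=
  zchar (fun i => zchar (M i) b) a.

(** Monomials are written with the Y_i before the W_j. In X^g X^h only the Y-part
    of h has to move to the left, past both parts of g, so the W-part of h does
    not enter. *)
Definition exps_form (g h : exps) : k :=
  zbichar MY g.1 h.1 * zbichar MW g.2 h.1.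

Lemma zbichar_neq0 (M : nat -> nat -> k) a b :
  (forall i j, M i j != 0) -> zbichar M a b != 0.
Proof. by move=> M0; apply: zchar_neq0 => i; apply: zchar_neq0. Qed.

Lemma zbicharDl (M : nat -> nat -> k) a b c : (forall i j, M i j != 0) ->
  zbichar M (a + b) c = zbichar M a c * zbichar M b c.
Proof. by move=> M0; apply: zcharD => i; apply: zchar_neq0. Qed.

Lemma zbicharDr (M : nat -> nat -> k) a b c : (forall i j, M i j != 0) ->
  zbichar M a (b + c) = zbichar M a b * zbichar M a c.
Proof.
move=> M0; rewrite -zchar_mul; apply: eq_bigr => i _.
by rewrite zcharD.
Qed.

Lemma exps_formDl a b c : exps_form (a + b) c = exps_form a c * exps_form b c.
Proof. by rewrite /exps_form !zbicharDl // mulrACA. Qed.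

Lemma exps_formDr a b c : exps_form a (b + c) = exps_form a b * exps_form a c.
Proof. by rewrite /exps_form !zbicharDr // mulrACA. Qed.

Lemma exps_form_neq0 a b : exps_form a b != 0.
Proof. by rewrite mulf_neq0 ?zbichar_neq0. Qed.

Definition exps_bichar : bichar k exps :=
  Bichar exps_formDl exps_formDr exps_form_neq0.

Definition eY (i : nat) : exps := ('X^i, 0).
Definition eW (j : nat) : exps := (0, 'X^j).

Lemma zbichar0l (M : nat -> nat -> k) a : zbichar M 0 a = 1.
Proof. by rewrite /zbichar /zchar size_poly0 big_ord0. Qed.

Lemma zbichar0r (M : nat -> nat -> k) a : zbichar M a 0 = 1.
Proof.
rewrite /zbichar /zchar big1 // => i _.
by rewrite size_poly0 big_ord0 exp1rz.
Qed.

Lemma bicharYY i j : exps_bichar (eY i) (eY j) = MY i j.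
Proof. by rewrite /= /exps_form /= zbichar0l mulr1 /zbichar !zcharX. Qed.

Lemma bicharWY i j : exps_bichar (eW i) (eY j) = MW i j.
Proof. by rewrite /= /exps_form /= zbichar0l mul1r /zbichar !zcharX. Qed.

Lemma bichar_W g j : exps_bichar g (eW j) = 1.
Proof. by rewrite /= /exps_form /= !zbichar0r mulr1. Qed.

End ExponentBichar.

(** The positive cone of a total order on the exponents; it compares the
    letters W_j first, and makes W_j smaller than W_j.+1. *)
Definition exps_pos (g : exps) : Prop :=
  0 < lead_coef g.2 \/ g.2 = 0 /\ 0 < lead_coef g.1.

Lemma lead_coef_gt0D (a b : {poly int}) :
  0 < lead_coef a -> 0 < lead_coef b -> 0 < lead_coef (a + b).
Proof.
move=> a0 b0; case: (ltngtP (size a) (size b)) => ab.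
- by rewrite addrC lead_coefDl.
- by rewrite lead_coefDl.
have ab0 : 0 < lead_coef a + lead_coef b by rewrite addr_gt0.
rewrite lead_coefE.
have -> : size (a + b) = size a.
  apply/eqP; rewrite eqn_leq (leq_trans (size_polyD _ _)) ?ab ?maxnn //=.
  have sz : (0 < size b)%N.
    by rewrite size_poly_gt0 -lead_coef_eq0 gt_eqF.
  rewrite -(prednK sz); apply: contraTT ab0; rewrite -leqNgt => le.
  by rewrite !lead_coefE ab -coefD nth_default.
by rewrite coefD -lead_coefE ab.
Qed.

Lemma exps_pos0 : ~ exps_pos 0.
Proof. by case=> [|[_]] /=; rewrite lead_coef0 ltxx. Qed.

Lemma exps_posD g h : exps_pos g -> exps_pos h -> exps_pos (g + h).
Proof.
case=> [g2|[g2 g1]] [h2|[h2 h1]].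
- by left; apply: lead_coef_gt0D.
- by left; rewrite /= h2 addr0.
- by left; rewrite /= g2 add0r.
- by right; rewrite /= g2 h2 addr0; split=> //; apply: lead_coef_gt0D.
Qed.

Lemma exps_pos_total g : [\/ g = 0, exps_pos g | exps_pos (- g)].
Proof.
have tot (a : {poly int}) : [\/ a = 0, 0 < lead_coef a | 0 < lead_coef (- a)].
  rewrite lead_coefN oppr_gt0; case: (ltrgt0P (lead_coef a)) => a0.
  - by apply: Or32.
  - by apply: Or33.
  - by apply: Or31; apply/eqP; rewrite -lead_coef_eq0 a0.
case: (tot g.2) => g2; last 2 first.
- by apply: Or32; left.
- by apply: Or33; left.
case: (tot g.1) => g1.
- by apply: Or31; rewrite [g]surjective_pairing g1 g2.
- by apply: Or32; right.
- by apply: Or33; right; rewrite /= g2 oppr0.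
Qed.

Lemma exps_posWW j : exps_pos (eW j.+1 - eW j).
Proof.
left; rewrite /= lead_coefDl ?size_polyN ?size_polyXn //.
by rewrite lead_coefXn.
Qed.


(** * Leading exponents of normal monomials *)

Section LeadingExponents.
Variables (G : zmodType) (eY eW : nat -> G) (tw : nat -> bool).

(** The letters Y_i^-1 W_j with j = i or j = i.+1 are the terms of the image of
    x_i, and eX i is the leading one when tw marks the W_j that are killed. *)
Definition eVW (i j : nat) : G := - eY i + eW j.
Definition eX (i : nat) : G := eVW i (if tw i.+1 then i else i.+1).

Definition lexp (e : seq (nat * nat)) : G :=
  \sum_(i < size e) (eY i *+ (nth (0, 0)%N e i).1 + eX i *+ (nth (0, 0)%N e i).2).

Lemma lexp_rcons e ab :
  lexp (rcons e ab) = lexp e + (eY (size e) *+ ab.1 + eX (size e) *+ ab.2).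
Proof.
rewrite /lexp size_rcons big_ord_recr /= nth_rcons ltnn eqxx; congr (_ + _).
by apply: eq_bigr => i _; rewrite nth_rcons ltn_ord.
Qed.

End LeadingExponents.

Lemma fst_lexp (tw : nat -> bool) e i :
  (lexp eY eW tw e).1`_i
  = (nth (0, 0)%N e i).1%:Z - (nth (0, 0)%N e i).2%:Z.
Proof.
have fstMn (g : exps) n : (g *+ n).1 = g.1 *+ n by exact: (raddfMn fst).
elim/last_ind: e => [|e [a b] IH].
  by rewrite /lexp big_ord0 coef0 nth_nil.
rewrite lexp_rcons /= !fstMn /= addr0 !coefD !coefMn coefN coefXn IH nth_rcons.
case: ltngtP => [ie|ie|->].
- by rewrite oppr0 !mul0rn !addr0.
- by rewrite nth_default ?(ltnW ie) //= oppr0 !mul0rn !addr0.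
- by rewrite nth_default //=; lia.
Qed.

Lemma snd_lexp_last (tw : nat -> bool) e j : (size e < j)%N ->
  (lexp eY eW tw e).2`_j = 0.
Proof.
have sndMn (g : exps) n : (g *+ n).2 = g.2 *+ n by exact: (raddfMn snd).
elim/last_ind: e => [|e [a b] IH]; first by rewrite /lexp big_ord0 coef0.
rewrite size_rcons => ej; rewrite lexp_rcons /= !sndMn /= mul0rn add0r oppr0 add0r.
rewrite coefD coefMn coefXn IH ?add0r 1?ltnW //.
by rewrite gtn_eqF ?mul0rn //; case: (tw _) => //; apply: ltnW.
Qed.

(** The exponent of Y_m only gives the difference of the last two entries; they
    are separated by the exponent of W_m.+1, or, when that letter is missing, by
    the vanishing of one of them. *)
Lemma lexp_inj (tw : nat -> bool) m (e f : seq (nat * nat)) :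
  size e = m -> size f = m ->
  (forall i, (i < m)%N -> tw i.+1 ->
     ((nth (0, 0)%N e i).1 == 0%N) || ((nth (0, 0)%N e i).2 == 0%N)) ->
  (forall i, (i < m)%N -> tw i.+1 ->
     ((nth (0, 0)%N f i).1 == 0%N) || ((nth (0, 0)%N f i).2 == 0%N)) ->
  lexp eY eW tw e = lexp eY eW tw f -> e = f.
Proof.
elim: m e f => [|m IH] e f; first by move=> /size0nil-> /size0nil->.
have sndMn (g : exps) n : (g *+ n).2 = g.2 *+ n by exact: (raddfMn snd).
case/lastP: e => // e [a b]; case/lastP: f => // f [c d].
rewrite !size_rcons => -[se] [sf] oke okf E.
have Ediff : a%:Z - b%:Z = c%:Z - d%:Z.
  have := congr1 (fun g : exps => g.1`_m) E; rewrite !fst_lexp !nth_rcons.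
  by rewrite se sf ltnn eqxx.
have [ab cd] : a = c /\ b = d.
  have [wT|wT] := boolP (tw m.+1).
    have := okf m (ltnSn m) wT; have := oke m (ltnSn m) wT.
    by rewrite !nth_rcons se sf ltnn eqxx /=; lia.
  have : b%:Z = d%:Z.
    have := congr1 (fun g : exps => g.2`_m.+1) E; rewrite !lexp_rcons /= !sndMn.
    rewrite /= !mul0rn !add0r !oppr0 !add0r !coefD !snd_lexp_last ?se ?sf //.
    by rewrite (negPf wT) !coefMn !coefXn eqxx !add0r; lia.
  by lia.
rewrite ab cd; congr (rcons _ _); apply: IH => //.
- by move=> i im; have := oke i (ltnW im); rewrite nth_rcons se im.
- by move=> i im; have := okf i (ltnW im); rewrite nth_rcons sf im.
by move: E; rewrite !lexp_rcons se sf ab cd => /addIr.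
Qed.


(** * Solutions of the defining relations in a torus *)

Lemma eq_lincomb2 (k : pzRingType) (V : lmodType k) (a b a' b' : k) (u v : V) :
  a = a' -> b = b' -> a *: u + b *: v = a' *: u + b' *: v.
Proof. by move=> -> ->. Qed.

Lemma eVWE (G : zmodType) (eY eW : nat -> G) i j : eVW eY eW i j = - eY i + eW j.
Proof. by []. Qed.

(* Unification would otherwise compare monomials by unfolding them down to
   finitely supported functions. *)
#[local] Opaque tmon eVW torus_mul.

Section TorusSolution.
Variables (k : fieldType) (p q : nat -> k) (gam : nat -> nat -> k).
Hypothesis p0 : forall i, p i != 0.
Hypothesis q0 : forall i, q i != 0.
Hypothesis gam0 : forall i j, gam i j != 0.
Hypothesis gamV : forall i j, gam j i = (gam i j)^-1.
Hypothesis gamI : forall i, gam i i = 1.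

(** Values of the bicharacter on pairs of letters Y_i, Y_j and W_j, Y_i. Only
    the quotients MY i j / MY j i and MW j i matter, which are the commutation
    factors in K_n of y_i with y_j and of Om j with y_i. *)
Definition MY (i j : nat) : k := if (i < j)%N then gam i j else 1.
Definition MW (j i : nat) : k := if (i < j)%N then q i else p i.

Lemma MY_neq0 i j : MY i j != 0.
Proof. by rewrite /MY; case: ifP; rewrite ?oner_neq0. Qed.

Lemma MW_neq0 j i : MW j i != 0.
Proof. by rewrite /MW; case: ifP. Qed.

Lemma MW_lt j i : (i < j)%N -> MW j i = q i.
Proof. by rewrite /MW => ->. Qed.

Lemma MW_ge j i : (j <= i)%N -> MW j i = p i.
Proof. by rewrite /MW ltnNge => ->. Qed.

Lemma MY_ratio i j : MY i j / MY j i = gam i j.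
Proof.
rewrite /MY; case: ltngtP => [ij|ji|->].
- by rewrite divr1.
- by rewrite [RHS]gamV div1r.
- by rewrite divr1 gamI.
Qed.

Variables (G : zmodType) (s : bichar k G) (eY eW : nat -> G).
Hypothesis bicharYY : forall i j, s (eY i) (eY j) = MY i j.
Hypothesis bicharWY : forall j i, s (eW j) (eY i) = MW j i.
Hypothesis bichar_W : forall g j, s g (eW j) = 1.

Local Notation "[ 'Y' i ]" := (tmon s (eY i)).
Local Notation "[ 'W' j ]" := (tmon s (eW j)).

Local Notation "[ 'VW' i j ]" := (tmon s (eVW eY eW i j))
  (i at level 0, j at level 0).

Lemma YY_comm i j : [Y i] * [Y j] = gam i j *: ([Y j] * [Y i]).
Proof. by rewrite tmonC !bicharYY MY_ratio. Qed.

Lemma VWY_comm i a j : [VW i a] * [Y j] = (MW a j * gam j i) *: ([Y j] * [VW i a]).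
Proof.
rewrite tmonC !eVWE bicharDl bicharDr bicharNl bicharNr bicharWY bichar_W !bicharYY.
by rewrite -MY_ratio mulr1 invrK; congr (_ *: _); ring.
Qed.

Lemma bicharVWVW i a j b : s (eVW eY eW i a) (eVW eY eW j b) = MY i j / MW a j.
Proof.
rewrite !eVWE bicharDl !bicharDr !bicharNl !bicharNr !bichar_W bicharWY bicharYY.
by rewrite invr1 !mulr1 invrK.
Qed.

Lemma VWVW_comm i a j b : [VW i a] * [VW j b] =
  (MW b i / MW a j * gam i j) *: ([VW j b] * [VW i a]).
Proof.
rewrite tmonC !bicharVWVW -MY_ratio; congr (_ *: _).
have := (MY_neq0 i j, MY_neq0 j i, MW_neq0 a j, MW_neq0 b i).
by move=> [[[? ?] ?] ?]; field; apply/and3P; split.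
Qed.

Lemma Y_VW i a : [Y i] * [VW i a] = [W a].
Proof.
rewrite tmonM !eVWE bicharDr bicharNr bicharYY bichar_W /MY ltnn invr1 mulr1 scale1r.
by rewrite addrA subrr add0r.
Qed.

End TorusSolution.

(** The relations are verified in any algebra with elements Y, W and
    VW = Y^-1 W that commute in the right way. *)
Section AlgebraSolution.
Variables (k : fieldType) (p q : nat -> k) (gam : nat -> nat -> k).
Hypothesis gamI : forall i, gam i i = 1.
Variables (D : algType k) (Y W : nat -> D) (VW : nat -> nat -> D).
Local Notation MW := (MW p q).
Hypothesis YY : forall i j, Y i * Y j = gam i j *: (Y j * Y i).
Hypothesis VWY : forall i a j,
  VW i a * Y j = (MW a j * gam j i) *: (Y j * VW i a).
Hypothesis VWVW : forall i a j b,
  VW i a * VW j b = (MW b i / MW a j * gam i j) *: (VW j b * VW i a).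
Hypothesis YVW : forall i a, Y i * VW i a = W a.

Variables eta omega alpha beta : nat -> k.
(** Every off-diagonal relation holds for arbitrary coefficients eta, alpha and
    beta, because W_i and W_i.+1 commute in the same way with the letters of
    index other than i. Only the relation between x_i and y_i links them, to the
    coefficient omega of W. *)
Definition solY i : D := eta i *: Y i.
Definition solX i : D := alpha i *: VW i i.+1 + beta i *: VW i i.
Definition solW j : D := omega j *: W j.

Lemma solY_solY i j : solY i * solY j = gam i j *: (solY j * solY i).
Proof.
rewrite /solY -!scalerAl -!scalerAr YY !scalerA; congr (_ *: _); ring.
Qed.

Lemma solX_solY i j c : MW i.+1 j = c -> MW i j = c ->
  solX i * solY j = (c * gam j i) *: (solY j * solX i).
Proof.
move=> c1 c2; rewrite /solX /solY mulrDl mulrDr scalerDr -!scalerAl -!scalerAr.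
by rewrite !VWY c1 c2 !scalerA; apply: eq_lincomb2; ring.
Qed.

Lemma solX_solY_lt i j : (i < j)%N ->
  solX i * solY j = (p j * gam j i) *: (solY j * solX i).
Proof. by move=> ij; apply: solX_solY; rewrite MW_ge // ltnW. Qed.

Lemma solX_solY_gt i j : (j < i)%N ->
  solX i * solY j = (q j * gam j i) *: (solY j * solX i).
Proof. by move=> ji; apply: solX_solY; rewrite MW_lt // ltnW. Qed.

Lemma solX_solX i j : (i < j)%N ->
  solX i * solX j = (q i * (p j)^-1 * gam i j) *: (solX j * solX i).
Proof.
move=> ij; have q1 : MW j.+1 i = q i by rewrite MW_lt ?ltnS // ltnW.
have q2 : MW j i = q i by rewrite MW_lt.
have p1 : MW i.+1 j = p j by rewrite MW_ge.
have p2 : MW i j = p j by rewrite MW_ge // ltnW.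
rewrite /solX !mulrDl !mulrDr !scalerDr -!scalerAl -!scalerAr.
rewrite (VWVW i i.+1 j j.+1) (VWVW i i.+1 j j) (VWVW i i j j.+1) (VWVW i i j j).
rewrite q1 q2 p1 p2 !scalerA.
by rewrite addrACA; congr (_ + _); apply: eq_lincomb2; ring.
Qed.

Lemma solY_solX i :
  solY i * solX i = (eta i * alpha i) *: W i.+1 + (eta i * beta i) *: W i.
Proof. by rewrite /solY /solX mulrDr -!scalerAl -!scalerAr !YVW !scalerA. Qed.

Lemma solW_step i : eta i * (q i - p i) * alpha i = omega i.+1 ->
  eta i * (q i - p i) * beta i = - omega i ->
  solW i.+1 = solW i + (q i - p i) *: (solY i * solX i).
Proof.
move=> Ea Eb; rewrite solY_solX scalerDr !scalerA /solW addrCA -scalerDl -Ea.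
have -> : omega i = - (eta i * (q i - p i) * beta i) by rewrite Eb opprK.
by rewrite -[LHS]addr0 -[X in _ + X](scale0r (W i)); apply: eq_lincomb2; ring.
Qed.

Lemma solX_solY_eq i : eta i * (q i - p i) * beta i = - omega i ->
  solX i * solY i = q i *: (solY i * solX i) + solW i.
Proof.
move=> Eb; rewrite solY_solX /solX /solY mulrDl -!scalerAl -!scalerAr !VWY !YVW.
rewrite gamI !mulr1 MW_lt // MW_ge // /solW scalerDr !scalerA -addrA -scalerDl.
have -> : omega i = - (eta i * (q i - p i) * beta i) by rewrite Eb opprK.
by apply: eq_lincomb2; ring.
Qed.

End AlgebraSolution.


(** * Normal monomials span *)

Section Spanning.
Variables (k : fieldType) (R : algType k) (J : ideal R) (N : nat).
Variables (x y : nat -> R) (p q : nat -> k) (gam : nat -> nat -> k).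
Variables tx ty tw : nat -> bool.

Definition Om (j : nat) : R := \sum_(l < j) (q l - p l) *: (y l * x l).

Hypothesis p0 : forall i, p i != 0.
Hypothesis q0 : forall i, q i != 0.
Hypothesis pq : forall i, p i != q i.
Hypothesis gam0 : forall i j, gam i j != 0.
Hypothesis gamV : forall i j, gam j i = (gam i j)^-1.
Hypothesis yy : forall i j, (i < N)%N -> (j < N)%N ->
  y i * y j = gam i j *: (y j * y i).
Hypothesis xy_lt : forall i j, (i < j)%N -> (j < N)%N ->
  x i * y j = (p j * gam j i) *: (y j * x i).
Hypothesis xy_gt : forall i j, (j < i)%N -> (i < N)%N ->
  x i * y j = (q j * gam j i) *: (y j * x i).
Hypothesis xx : forall i j, (i < j)%N -> (j < N)%N ->
  x i * x j = (q i * (p j)^-1 * gam i j) *: (x j * x i).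
Hypothesis xy_eq : forall i, (i < N)%N -> x i * y i = q i *: (y i * x i) + Om i.
Hypothesis Jx : forall i, (i < N)%N -> tx i -> ideal_set J (x i).
Hypothesis Jy : forall i, (i < N)%N -> ty i -> ideal_set J (y i).
Hypothesis JOm : forall j, (j <= N)%N -> tw j -> ideal_set J (Om j).

(** Commutation up to a scalar whose value is irrelevant to spanning. *)
Definition qcomm (u v : R) : Prop := exists c : k, u * v = c *: (v * u).

Lemma qcommM u u' v : qcomm u v -> qcomm u' v -> qcomm (u * u') v.
Proof.
move=> [c uv] [c' uv']; exists (c' * c).
by rewrite -mulrA uv' -scalerAr [u * (v * _)]mulrA uv -scalerAl scalerA -mulrA.
Qed.

Lemma qcommX u v m : qcomm u v -> qcomm (u ^+ m) v.
Proof.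
move=> uv; elim: m => [|m IH]; last by rewrite exprS; apply: qcommM.
by exists 1; rewrite expr0 mulr1 mul1r scale1r.
Qed.

Lemma qcomm_sym (c : k) u v : c != 0 -> u * v = c *: (v * u) -> qcomm v u.
Proof. by move=> c0 uv; exists c^-1; rewrite uv scalerA mulVf // scale1r. Qed.

Lemma qcomm_mon m i a b z : (i < m)%N -> (m < N)%N -> z = x i \/ z = y i ->
  qcomm (y m ^+ a * x m ^+ b) z.
Proof.
move=> im mN zi; suff [qy qx] : qcomm (y m) z /\ qcomm (x m) z.
  by apply: qcommM; apply: qcommX.
case: zi => ->; split.
- by apply: (qcomm_sym _ (xy_lt im mN)); rewrite mulf_neq0.
- by apply: (qcomm_sym _ (xx im mN)); rewrite !mulf_neq0 ?invr_eq0.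
- by eexists; apply: yy => //; apply: ltn_trans mN.
- by eexists; apply: xy_gt.
Qed.

(** All terms of Om m commute with y m up to the same factor, and likewise with
    x m: the powers of gamma that come from y_l and from x_l cancel. *)
Lemma yOm m : (m < N)%N -> y m * Om m = (p m)^-1 *: (Om m * y m).
Proof.
move=> mN; rewrite /Om mulr_sumr mulr_suml scaler_sumr; apply: eq_bigr => l _.
have lm := ltn_ord l; have lN := ltn_trans lm mN.
rewrite -scalerAr -scalerAl -mulrA (xy_lt lm mN) -!scalerAr !mulrA (yy lN mN).
rewrite -!scalerAl !scalerA; congr (_ *: _).
rewrite (gamV l m).
have := (p0 m, gam0 l m) => -[p' g']; field; exact/andP.
Qed.

Lemma xOm m : (m < N)%N -> x m * Om m = p m *: (Om m * x m).
Proof.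
move=> mN; rewrite /Om mulr_sumr mulr_suml scaler_sumr; apply: eq_bigr => l _.
have lm := ltn_ord l; have lN := ltn_trans lm mN.
rewrite -scalerAr -scalerAl mulrA (xy_gt lm mN) -!scalerAl -!mulrA (xx lm mN).
rewrite -!scalerAr !scalerA; congr (_ *: _).
have := (p0 m, gam0 l m) => -[p' g']; field; exact.
Qed.

(** Straightening y m past a power of x m only creates terms with Om m, hence
    with smaller indices. *)
Lemma xexp_mul_y m b : (m < N)%N -> exists c : k,
  x m ^+ b.+1 * y m = q m ^+ b.+1 *: (y m * x m ^+ b.+1) + c *: (Om m * x m ^+ b).
Proof.
move=> mN; elim: b => [|b [c IH]].
  by exists 1; rewrite expr0 !expr1 mulr1 scale1r xy_eq.
exists (q m ^+ b.+1 + c * p m).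
rewrite [x m ^+ b.+2]exprS -mulrA IH mulrDr -!scalerAr !mulrA xy_eq // xOm //.
rewrite mulrDl scalerDr -!scalerAl !scalerA -addrA -!mulrA -!exprS -scalerDl.
by rewrite -exprSr.
Qed.

Inductive span (S : R -> Prop) : R -> Prop :=
| span_ideal a of ideal_set J a : span S a
| span_add a b of span S a & span S b : span S (a + b)
| span_base a of S a : span S a.

Definition normal_pair (m a b : nat) : bool :=
  [&& tx m ==> (b == 0%N), ty m ==> (a == 0%N)
    & tw m.+1 ==> (a == 0%N) || (b == 0%N)].

(** The span, modulo J, of the normal monomials in the letters of index less
    than m. *)
Fixpoint tower (m : nat) : R -> Prop :=
  if m is m'.+1 then span (fun u => exists a b v,
    [/\ normal_pair m' a b, tower m' v & u = v * (y m' ^+ a * x m' ^+ b)])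
  else span (fun u => exists c : k, u = c%:A).

Lemma tower_add m u v : tower m u -> tower m v -> tower m (u + v).
Proof. by case: m => [|m]; apply: span_add. Qed.

Lemma tower_ideal m u : ideal_set J u -> tower m u.
Proof. by case: m => [|m]; apply: span_ideal. Qed.

Lemma tower_mon m a b v : normal_pair m a b -> tower m v ->
  tower m.+1 (v * (y m ^+ a * x m ^+ b)).
Proof. by move=> ab tv; apply: span_base; exists a, b, v. Qed.

Lemma towerZ m (c : k) u : tower m u -> tower m (c *: u).
Proof.
elim: m u => [|m IH] u; elim=> [a Ja|a b _ IHa _ IHb|a].
- by apply/span_ideal/idealZ.
- by rewrite scalerDr; apply: span_add.
- by case=> d ->; apply: span_base; exists (c * d); rewrite scalerA.
- by apply/span_ideal/idealZ.
- by rewrite scalerDr; apply: span_add.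
- by case=> a' [b' [v [ab tv ->]]]; rewrite scalerAl; apply: tower_mon => //; apply: IH.
Qed.

Lemma tower_sum m (I : Type) (r : seq I) (P : pred I) (F : I -> R) :
  (forall i, P i -> tower m (F i)) -> tower m (\sum_(i <- r | P i) F i).
Proof.
move=> tF; elim/big_ind: _ => //; last exact: tower_add.
by apply: tower_ideal; apply: ideal0.
Qed.

Lemma tower_widen m u : tower m u -> tower m.+1 u.
Proof.
move=> tu; rewrite -[u]mulr1 -[X in u * X]mulr1; apply: (@tower_mon m 0 0) => //.
by rewrite /normal_pair eqxx !implybT.
Qed.

(** Closure under right multiplication is what passes from one stage to the
    next; at the last stage it makes the tower the whole algebra. *)
Definition tower_closed m : Prop := forall i u, (i < m)%N -> tower m u ->
  tower m (u * x i) /\ tower m (u * y i).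

Lemma tower_mulOm m u : tower_closed m -> tower m u -> tower m (u * Om m).
Proof.
move=> cl tu; rewrite /Om mulr_sumr; apply: tower_sum => l _.
rewrite -scalerAr; apply: towerZ; rewrite mulrA.
have [_ tuy] := cl l u (ltn_ord l) tu.
by have [] := cl l _ (ltn_ord l) tuy.
Qed.

(** Modulo the ideal every power product y^a x^b may be used at the next
    stage, not only the normal ones: if Om m.+1 lies in the ideal, then y m x m
    is a multiple of Om m there, which belongs to the previous stage. *)
Lemma tower_all_mon m a b u : (m < N)%N -> tower_closed m -> tower m u ->
  tower m.+1 (u * (y m ^+ a * x m ^+ b)).
Proof.
move=> mN cl; elim: a b u => [|a IH] b u tu.
  have [xT|xT] := boolP (tx m && (b != 0%N)).
    case/andP: xT; case: b => // b xT _; apply: tower_ideal.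
    by apply: idealMl; apply: idealMl; rewrite exprS; apply: Defs.idealMr; apply: Jx.
  apply: tower_mon => //; rewrite /normal_pair eqxx !implybT /= andbT.
  by move: xT; rewrite negb_and negbK implybE.
have [yT|yT] := boolP (ty m).
  apply: tower_ideal; apply: idealMl; apply: Defs.idealMr; rewrite exprS.
  by apply: Defs.idealMr; apply: Jy.
case: b => [|b].
  by apply: tower_mon => //; rewrite /normal_pair eqxx orbT !implybT (negPf yT).
have [xT|xT] := boolP (tx m).
  apply: tower_ideal; apply: idealMl; apply: idealMl; rewrite exprS.
  by apply: Defs.idealMr; apply: Jx.
have [wT|wT] := boolP (tw m.+1); last first.
  by apply: tower_mon => //; rewrite /normal_pair (negPf xT) (negPf yT) (negPf wT).
have qp0 : q m - p m != 0 by rewrite subr_eq0 eq_sym.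
have yx : y m * x m = (q m - p m)^-1 *: Om m.+1 - (q m - p m)^-1 *: Om m.
  by rewrite -scalerBr /Om big_ord_recr /= addrAC subrr add0r scalerA mulVf ?scale1r.
have [c yaOm] : qcomm (y m ^+ a) (Om m).
  by apply: qcommX; exists (p m)^-1; apply: yOm.
have -> : u * (y m ^+ a.+1 * x m ^+ b.+1) =
    (q m - p m)^-1 *: (u * (y m ^+ a * Om m.+1 * x m ^+ b))
    - (c / (q m - p m)) *: ((u * Om m) * (y m ^+ a * x m ^+ b)).
  rewrite exprSr exprS -!mulrA [y m * (x m * _)]mulrA yx mulrBl !mulrBr.
  rewrite -!scalerAl -!scalerAr; congr (_ - _).
  rewrite [y m ^+ a * (Om m * _)]mulrA yaOm -scalerAl -scalerAr scalerA -!mulrA.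
  by congr (_ *: _); rewrite mulrC.
apply: tower_add.
  apply: towerZ; apply: tower_ideal; apply: idealMl; apply: Defs.idealMr.
  by apply: idealMl; apply: JOm.
by rewrite -scaleNr; apply: towerZ; apply: IH; apply: tower_mulOm.
Qed.

Lemma tower_closedS m : (m < N)%N -> tower_closed m -> tower_closed m.+1.
Proof.
move=> mN cl i u im; elim=> [a Ja|a b _ [IHa IHa'] _ [IHb IHb']|_ [a [b [v [_ tv ->]]]]].
- by split; apply/span_ideal/Defs.idealMr.
- by rewrite !mulrDl; split; apply: span_add.
move: im; rewrite ltnS leq_eqVlt => /orP[/eqP->|im].
  split; first by rewrite -!mulrA -exprSr; apply: tower_all_mon.
  case: b => [|b].
    have := @tower_all_mon m a.+1 0 v mN cl tv.
    by rewrite expr0 !mulr1 exprSr mulrA.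
  have [c] := xexp_mul_y b mN => xE.
  have [d yaOm] : qcomm (y m ^+ a) (Om m).
    by apply: qcommX; exists (p m)^-1; apply: yOm.
  rewrite -!mulrA xE !mulrDr -!scalerAr; apply: tower_add.
    by rewrite [y m ^+ a * _]mulrA -exprSr; apply: towerZ; apply: tower_all_mon.
  rewrite [y m ^+ a * _]mulrA yaOm -scalerAl -scalerAr scalerA; apply: towerZ.
  by rewrite !mulrA -mulrA; apply: tower_all_mon => //; apply: tower_mulOm.
have [tvx tvy] := cl i v im tv.
split.
  have [c E] := @qcomm_mon m i a b (x i) im mN (or_introl erefl).
  by rewrite -mulrA E -scalerAr (mulrA v); apply: towerZ; apply: tower_all_mon.
have [c E] := @qcomm_mon m i a b (y i) im mN (or_intror erefl).
by rewrite -mulrA E -scalerAr (mulrA v); apply: towerZ; apply: tower_all_mon.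
Qed.

Lemma tower_closedP m : (m <= N)%N -> tower_closed m.
Proof.
elim: m => [_ i u|m IH mN]; first by rewrite ltn0.
exact/tower_closedS/IH/ltnW.
Qed.

Lemma tower1 m : tower m 1.
Proof.
elim: m => [|m IH]; last exact: tower_widen.
by apply: span_base; exists 1; rewrite scale1r.
Qed.

(** ** Normal forms *)

(** The entry of rank i of e is the pair of exponents of y i and x i. Lists are
    used so that monomials grow by one letter pair at a time. *)
Definition mon (e : seq (nat * nat)) : R :=
  \prod_(i < size e) (y i ^+ (nth (0, 0)%N e i).1 * x i ^+ (nth (0, 0)%N e i).2).

Definition normal (e : seq (nat * nat)) : bool :=
  all (fun i => normal_pair i (nth (0, 0)%N e i).1 (nth (0, 0)%N e i).2) (iota 0 (size e)).

Lemma mon_rcons e ab :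
  mon (rcons e ab) = mon e * (y (size e) ^+ ab.1 * x (size e) ^+ ab.2).
Proof.
rewrite /mon size_rcons big_ord_recr /= nth_rcons ltnn eqxx; congr (_ * _).
by apply: eq_bigr => i _; rewrite nth_rcons ltn_ord.
Qed.

Lemma normal_rcons e ab :
  normal (rcons e ab) = normal e && normal_pair (size e) ab.1 ab.2.
Proof.
rewrite /normal size_rcons -addn1 iotaD all_cat /= andbT add0n.
rewrite nth_rcons ltnn eqxx; congr (_ && _); apply: eq_in_all => i.
by rewrite mem_iota => /andP[_ ie]; rewrite nth_rcons ie.
Qed.

Lemma msupp_lext (E E' : choiceType) (F : E -> {malg k[E']}) (g : {malg k[E]}) e' :
  e' \in msupp (lext F g) -> exists2 e, e \in msupp g & e' \in msupp (F e).
Proof.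
move=> e'g; apply: contrapT => none; move: e'g; rewrite -mcoeff_neq0 => /eqP; apply.
rewrite /lext raddf_sum big1_seq // => e /= eg; rewrite mcoeffZ.
rewrite (_ : (F e)@_e' = 0) ?mulr0 //; apply: mcoeff_outdom; apply/negP => eF.
by apply: none; exists e.
Qed.

Lemma tower_normal_form m u : tower m u -> exists g : {malg k[seq (nat * nat)]},
  (forall e, e \in msupp g -> size e = m /\ normal e) /\ ideal_set J (u - lext mon g).
Proof.
have add v w (g h : {malg k[seq (nat * nat)]}) : ideal_set J (v - lext mon g) ->
    ideal_set J (w - lext mon h) -> ideal_set J (v + w - lext mon (g + h)).
  by move=> Jv Jw; rewrite linearD opprD addrACA; apply: idealD.
have suppD (P : seq (nat * nat) -> Prop) (g h : {malg k[seq (nat * nat)]}) :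
    (forall e, e \in msupp g -> P e) -> (forall e, e \in msupp h -> P e) ->
    forall e, e \in msupp (g + h) -> P e.
  by move=> Pg Ph e /(fsubsetP (msuppD_le _ _)); rewrite in_fsetU => /orP[/Pg|/Ph].
elim: m u => [|m IH] u; elim=> [a Ja|a b _ [g [gs Jg]] _ [h [hs Jh]]|a].
- by exists 0; rewrite linear0 subr0; split=> // e; rewrite msupp0.
- by exists (g + h); split; [apply: suppD | apply: add].
- case=> c ->; exists (c *: << [::] >>); split.
    move=> e /(fsubsetP (msuppZ_le _ _)) /(fsubsetP msuppU_le).
    rewrite in_fset1 => /eqP->.
    by [].
  by rewrite linearZ /= lextU /mon big_ord0 subrr; apply: ideal0.
- by exists 0; rewrite linear0 subr0; split=> // e; rewrite msupp0.
- by exists (g + h); split; [apply: suppD | apply: add].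
case=> a' [b' [v [okab /IH[g [gs Jg]] ->]]].
exists (lext (fun e => << rcons e (a', b') >>) g); split.
  move=> e /msupp_lext[e' /gs[sz nrm]] /(fsubsetP msuppU_le).
  rewrite in_fset1 => /eqP->.
  by rewrite size_rcons normal_rcons sz nrm.
have -> : lext mon (lext (fun e => << rcons e (a', b') >>) g)
    = lext mon g * (y m ^+ a' * x m ^+ b').
  rewrite [X in lext mon X]/lext linear_sum /lext mulr_suml.
  apply: eq_big_seq => e /gs[sz _]; rewrite linearZ /= lextU.
  by rewrite mon_rcons sz scalerAl.
by rewrite -mulrBl; apply: Defs.idealMr.
Qed.

End Spanning.


(** * Morphisms and ideals of the algebra *)

Section KnQuotientLift.
Variables (k : fieldType) (n : nat) (p q : 'I_n -> k) (gamma : 'M[k]_n).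
Variables (B : algType k) (F : {lrmorphism free_alg k (Kn_gens n) -> B}).
Hypothesis F0 : forall r, Kn_rels p q gamma r -> F r = 0.

Definition Kn_factor : Kn p q gamma -> B := quot_lift (rels_kernel F0).
HB.instance Definition _ := GRing.RMorphism.on Kn_factor.
HB.instance Definition _ := GRing.Linear.on Kn_factor.

Lemma Kn_factorE a : Kn_factor (Kn_pi p q gamma a) = F a.
Proof. exact: quot_liftE. Qed.

End KnQuotientLift.

Section KnTools.
Variables (k : fieldType) (n : nat) (p q : 'I_n -> k) (gamma : 'M[k]_n).
Local Notation K := (Kn p q gamma).
Local Notation x := (Kx p q gamma).
Local Notation y := (Ky p q gamma).

(** The universal property of the presentation. *)
Lemma Kn_lift (B : algType k) (X Y : 'I_n -> B) :
  (forall i j, Y i * Y j = gamma i j *: (Y j * Y i)) ->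
  (forall i j : 'I_n, (i < j)%N -> X i * Y j = (p j * gamma j i) *: (Y j * X i)) ->
  (forall i j : 'I_n, (j < i)%N -> X i * Y j = (q j * gamma j i) *: (Y j * X i)) ->
  (forall i j : 'I_n, (i < j)%N ->
     X i * X j = (q i * (p j)^-1 * gamma i j) *: (X j * X i)) ->
  (forall i, X i * Y i = q i *: (Y i * X i)
     + \sum_(l < n | (l < i)%N) (q l - p l) *: (Y l * X l)) ->
  exists f : {lrmorphism K -> B},
    (forall i, f (x i) = X i) /\ (forall i, f (y i) = Y i).
Proof.
move=> YY XYlt XYgt XX XYeq.
pose v (g : Kn_gens n) : B := match g with inl i => X i | inr i => Y i end.
pose F : {lrmorphism free_alg k (Kn_gens n) -> B} := @free_lift k (Kn_gens n) B v.
have Fg g : F (free_gen k g) = v g by exact: free_lift_gen.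
have FM g h : F (free_gen k g * free_gen k h) = v g * v h by rewrite rmorphM /= !Fg.
have FZ c g h : F (c *: (free_gen k g * free_gen k h)) = c *: (v g * v h).
  by rewrite linearZ /= FM.
have F0 : forall r, Kn_rels p q gamma r -> F r = 0.
  move=> r; case=> [i j|i j ij|i j ij|i j ij|i]; rewrite linearB /= FM.
  - by rewrite FZ /= YY subrr.
  - by rewrite FZ /= XYlt ?subrr.
  - by rewrite FZ /= XYgt ?subrr.
  - by rewrite FZ /= XX ?subrr.
  rewrite linearD /= FZ linear_sum /= XYeq.
  by apply/eqP; rewrite subr_eq0; apply/eqP; congr (_ + _); apply: eq_bigr => l _; rewrite FZ.
by exists (Kn_factor F0); split=> i; rewrite [LHS]Kn_factorE Fg.
Qed.

Lemma Kn_ind (P : K -> Prop) : P 1 -> (forall a b, P a -> P b -> P (a + b)) ->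
  (forall c a, P a -> P (c *: a)) ->
  (forall a i, P a -> P (a * x i)) -> (forall a i, P a -> P (a * y i)) ->
  forall a, P a.
Proof.
move=> P1 PD PZ Px Py; apply: quot_piP => a; rewrite -/(Kn_pi p q gamma a).
elim/malg_linear_ind: a => [|a b Pa Pb|c [m]].
- by rewrite linear0 -(scale0r 1); apply: PZ.
- by rewrite linearD; apply: PD.
rewrite linearZ /=; apply: PZ; elim/last_ind: m => [|m g IH].
  suff -> : << FMonom [::] >> = 1 :> free_alg k (Kn_gens n) by rewrite rmorph1.
  by congr << _ >>; rewrite /mone /= fmoneE.
have -> : << FMonom (rcons m g) >> = << FMonom m >> * free_gen k g :> free_alg k (Kn_gens n).
  by rewrite /GRing.mul /= fgmulUU mulr1 /mmul /= fmmulE fmuE cats1.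
by rewrite rmorphM /=; case: g => i; [apply: Px | apply: Py].
Qed.

Lemma ideal_gen_eigen_stable (T : set K) :
  (forall t, T t -> forall h : Hgroup k n, exists c : k, Hact h t = c *: t) ->
  Hstable (ideal_gen T).
Proof.
move=> eig; have sub h a : ideal_set (ideal_gen T) a -> ideal_set (ideal_gen T) (Hact h a).
  pose I := [set a : K | ideal_set (ideal_gen T) (Hact h a)]%classic.
  have I0 : I 0 by rewrite /I /mkset linear0; apply: ideal0.
  have ID u v : I u -> I v -> I (u + v).
    by rewrite /I /mkset linearD; apply: idealD.
  have Il u v : I v -> I (u * v).
    by rewrite /I /mkset rmorphM; apply: Defs.idealMl.
  have Ir u v : I u -> I (u * v).
    by rewrite /I /mkset rmorphM; apply: Defs.idealMr.
  apply: (@ideal_gen_sub _ T (@Ideal _ I I0 ID Il Ir)) => t Tt.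
  have [c tc] := eig t Tt h; rewrite /= /I /mkset tc; apply: idealZ.
  exact: sub_ideal_gen.
move=> h; apply/seteqP; split=> [_ [a Ta <-]|a Ta]; first exact: sub.
by exists (Hact (Hinv h) a); [apply: sub | apply: HactVK].
Qed.

(** On each y_l x_l the group acts by h_{2l-1} h_{2l}, which does not depend on l
    by the definition of H; hence the Omega_i are eigenvectors too. *)
Lemma calP_eigen (t : K) : calP p q gamma t ->
  forall h : Hgroup k n, exists c : k, Hact h t = c *: t.
Proof.
case=> [[[i _ <-]|[i _ <-]]|[i _ <-]] h.
- by exists (h (inl i)); apply: Hact_x.
- by exists (h (inr i)); apply: Hact_y.
exists (h (inl i) * h (inr i)); rewrite /KOmega linear_sum scaler_sumr.
apply: eq_bigr => l _; rewrite linearZ /= rmorphM /= Hact_x Hact_y.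
rewrite -scalerAl -scalerAr !scalerA; congr (_ *: _).
by rewrite (Hval_eq h i l); ring.
Qed.

(** If a lies in I but not in Q, then a b in Q for every b in J puts J inside
    Q. *)
Lemma completely_prime_Hprime (Q : ideal K) :
  completely_prime Q -> Hstable Q -> Hprime Q.
Proof.
move=> [Q1 Qdom] st; split=> //.
  move=> QT; case/eqP: Q1; rewrite -(rmorph1 (quot_pi Q)); apply/quot_pi_eq0.
  by rewrite QT.
move=> I J _ _ IJ; have [IQ|nIQ] := pselect (I `<=` Q)%classic; first by left.
right=> b Jb; have [a Ia nQa] : exists2 a, ideal_set I a & ~ ideal_set Q a.
  apply: contrapT => none; apply: nIQ => a Ia; apply: contrapT => nQa.
  by apply: none; exists a.
have Qab : ideal_set Q (a * b) by apply: IJ; apply: sub_ideal_gen; exists a => //; exists b.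
have : quot_pi Q a * quot_pi Q b = 0 by rewrite -rmorphM; apply/quot_pi_eq0.
by case/Qdom => /quot_pi_eq0.
Qed.

Lemma kernel_completely_prime (B : algType k) (f : {lrmorphism K -> B}) (Q : ideal K) :
  (forall a b : B, a * b = 0 -> a = 0 \/ b = 0) ->
  (forall a, ideal_set Q a <-> f a = 0) -> completely_prime Q.
Proof.
move=> Bdom Qf; split.
  apply/eqP; rewrite -(rmorph1 (quot_pi Q)) => /quot_pi_eq0/Qf/eqP.
  by rewrite rmorph1 oner_eq0.
elim/quot_piP => a; elim/quot_piP => b; rewrite -rmorphM => /quot_pi_eq0/Qf.
by rewrite rmorphM => /Bdom[] /Qf/quot_pi_eq0; [left|right].
Qed.

End KnTools.


(** * The kernel of the torus representation *)

Section AdmissibleIdeal.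
Variables (k : fieldType) (n : nat) (p q : 'I_n.+1 -> k) (gamma : 'M[k]_n.+1).
Hypothesis p0 : forall i, p i != 0.
Hypothesis q0 : forall i, q i != 0.
Hypothesis pq : forall i, p i != q i.
Hypothesis gamma0 : forall i j, gamma i j != 0.
Hypothesis gammaV : forall i j, gamma j i = (gamma i j)^-1.
Hypothesis gammaI : forall i, gamma i i = 1.
Variable T : set (Kn p q gamma).
Hypothesis admT : admissible T.

Local Notation K := (Kn p q gamma).
Local Notation J := (ideal_gen T).
Local Notation N := n.+1.

(* Indices are natural numbers below, so that stages and sums can be built by
   induction; inord sends those beyond n to 0. *)
Let P (i : nat) : k := p (inord i).
Let Q (i : nat) : k := q (inord i).
Let gam (i j : nat) : k := gamma (inord i) (inord j).
Let x (i : nat) : K := Kx p q gamma (inord i).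
Let y (i : nat) : K := Ky p q gamma (inord i).

Let P0 i : P i != 0. Proof. exact: p0. Qed.
Let Q0 i : Q i != 0. Proof. exact: q0. Qed.
Let PQ i : P i != Q i. Proof. exact: pq. Qed.
Let QP0 i : Q i - P i != 0. Proof. by rewrite subr_eq0 eq_sym. Qed.
Let gam0 i j : gam i j != 0. Proof. exact: gamma0. Qed.
Let gamV i j : gam j i = (gam i j)^-1. Proof. exact: gammaV. Qed.
Let gamI i : gam i i = 1. Proof. exact: gammaI. Qed.

(** Om 0 is zero, and it counts as a member of T; this makes the two clauses of
    admissibility one. *)
Definition in_x (i : nat) : bool := `[< T (Kx p q gamma (inord i)) >].
Definition in_y (i : nat) : bool := `[< T (Ky p q gamma (inord i)) >].
Definition in_Om (j : nat) : bool :=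
  if j is i.+1 then `[< T (KOmega p q gamma (inord i)) >] else true.

Lemma admissible_in i : (i < N)%N -> in_x i || in_y i = in_Om i && in_Om i.+1.
Proof.
move=> iN; have [_ adm1 adm0] := admT.
have -> : in_x i || in_y i
    = `[< T (Kx p q gamma (inord i)) \/ T (Ky p q gamma (inord i)) >].
  by rewrite asbool_or.
case: i iN => [|i] iN /=.
  by apply: asbool_equiv_eq; apply: adm0; rewrite inordK.
rewrite andbC -asbool_and; apply: asbool_equiv_eq; apply: adm1.
by rewrite !inordK // ltnW.
Qed.

Lemma Om_sum (B : algType k) (X Y : nat -> B) j : (j <= N)%N ->
  Om X Y P Q j = \sum_(l < N | (l < j)%N) (q l - p l) *: (Y l * X l).
Proof.
move=> jN; rewrite /Om (big_ord_widen N (fun l => (Q l - P l) *: (Y l * X l))) //.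
by apply: eq_bigr => l _; rewrite /P /Q inord_val.
Qed.

Lemma Om_KOmega i : (i < N)%N -> Om x y P Q i.+1 = KOmega p q gamma (inord i).
Proof.
move=> iN; rewrite Om_sum //; apply: eq_big => [l|l _]; first by rewrite inordK.
by rewrite /x /y inord_val.
Qed.

(** ** Spanning by normal monomials *)

Lemma mem_x i : in_x i -> ideal_set J (x i).
Proof. by move=> /asboolP Ti; apply: sub_ideal_gen. Qed.

Lemma mem_y i : in_y i -> ideal_set J (y i).
Proof. by move=> /asboolP Ti; apply: sub_ideal_gen. Qed.

Lemma mem_Om j : (j <= N)%N -> in_Om j -> ideal_set J (Om x y P Q j).
Proof.
case: j => [_ _|j jN /asboolP Tj]; first by rewrite /Om big_ord0; apply: ideal0.
by rewrite Om_KOmega //; apply: sub_ideal_gen.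
Qed.

Lemma tower_full u : tower J x y in_x in_y in_Om N u.
Proof.
have cl : tower_closed J x y in_x in_y in_Om N.
  apply: (@tower_closedP _ _ _ N _ _ P Q gam) => //.
  - by move=> i j _ _; apply: Kn_yy.
  - by move=> i j ij jN; apply: Kn_xy_lt; rewrite !inordK // (ltn_trans ij).
  - by move=> i j ij jN; apply: Kn_xy_gt; rewrite !inordK // (ltn_trans ij).
  - by move=> i j ij jN; apply: Kn_xx; rewrite !inordK // (ltn_trans ij).
  - move=> i iN; rewrite /x /y Kn_xy_eq; congr (_ + _); rewrite Om_sum ?(ltnW iN) //.
    by apply: eq_big => [l|l _]; rewrite ?inordK // /x /y inord_val.
  - by move=> i _; apply: mem_x.
  - by move=> i _; apply: mem_y.
  - exact: mem_Om.
elim/Kn_ind: u => [|a b|c a|a i ta|a i ta].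
- exact: tower1.
- exact: tower_add.
- exact: towerZ.
- by have [+ _] := cl i a (ltn_ord i) ta; rewrite /x inord_val.
- by have [_ +] := cl i a (ltn_ord i) ta; rewrite /y inord_val.
Qed.

(** ** The images of the generators *)

Variables (G : zmodType) (s : bichar k G) (eY eW : nat -> G).
Hypothesis bicharYY : forall i j, s (eY i) (eY j) = MY gam i j.
Hypothesis bicharWY : forall j i, s (eW j) (eY i) = MW P Q j i.
Hypothesis bichar_W : forall g j, s g (eW j) = 1.

Variable pos : G -> Prop.
Hypothesis pos0 : ~ pos 0.
Hypothesis posD : forall g h, pos g -> pos h -> pos (g + h).
Hypothesis pos_total : forall g, [\/ g = 0, pos g | pos (- g)].
Hypothesis posWW : forall j, pos (eW j.+1 - eW j).
Hypothesis lexp_sep : forall e f, size e = N -> size f = N ->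
  (forall i, (i < N)%N -> in_Om i.+1 ->
     ((nth (0, 0)%N e i).1 == 0%N) || ((nth (0, 0)%N e i).2 == 0%N)) ->
  (forall i, (i < N)%N -> in_Om i.+1 ->
     ((nth (0, 0)%N f i).1 == 0%N) || ((nth (0, 0)%N f i).2 == 0%N)) ->
  lexp eY eW in_Om e = lexp eY eW in_Om f -> e = f.

(** The coefficients of the images. If only y_i is in T, the image of x_i is
    Y_i^-1 W_i: the letter is free to choose there, because both sides of the
    relation for x_i y_i vanish, and W_i.+1 would do as well. *)
Definition eta (i : nat) : k := (~~ in_y i)%:R.
Definition omega (j : nat) : k := (~~ in_Om j)%:R.
Definition alpha (i : nat) : k :=
  if in_x i || in_y i then 0 else omega i.+1 / (Q i - P i).
Definition beta (i : nat) : k :=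
  if in_x i then 0 else if in_y i then 1 else - omega i / (Q i - P i).

Lemma alphaE i : (i < N)%N -> eta i * (Q i - P i) * alpha i = omega i.+1.
Proof.
move=> iN; rewrite /alpha /eta /omega; have := admissible_in iN.
case: (in_x i) (in_y i) (in_Om i) (in_Om i.+1) => [] [] [] [] //= _;
  rewrite /= ?mulr0n ?mulr1n; by [ring | field; exact: QP0].
Qed.

Lemma betaE i : (i < N)%N -> eta i * (Q i - P i) * beta i = - omega i.
Proof.
move=> iN; rewrite /beta /eta /omega; have := admissible_in iN.
case: (in_x i) (in_y i) (in_Om i) (in_Om i.+1) => [] [] [] [] //= _;
  rewrite /= ?mulr0n ?mulr1n; by [ring | field; exact: QP0].
Qed.

Local Notation Y := (fun i => tmon s (eY i)).
Local Notation W := (fun j => tmon s (eW j)).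
Local Notation VW := (fun i j => tmon s (eVW eY eW i j)).
Local Notation Xs := (solX VW alpha beta).
Local Notation Ys := (solY Y eta).
Local Notation Ws := (solW W omega).

(** The images of the elements Om j telescope. *)
Lemma Ws_Om j : (j <= N)%N -> Om Xs Ys P Q j = Ws j.
Proof.
elim: j => [_|j IH jN]; first by rewrite /Om big_ord0 /solW /omega scale0r.
rewrite (@solW_step _ P Q _ Y W VW (Y_VW bicharYY bichar_W) eta omega
  alpha beta).
- by rewrite -IH ?(ltnW jN) // /Om big_ord_recr.
- exact: alphaE.
- exact: betaE.
Qed.

Lemma torus_representation : exists f : {lrmorphism K -> torus_of s},
  (forall i, (i < N)%N -> f (x i) = Xs i) /\ (forall i, (i < N)%N -> f (y i) = Ys i).
Proof.
have YYc := YY_comm gamV gamI bicharYY.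
have VWYc := VWY_comm gamV gamI bicharYY bicharWY bichar_W.
have VWVWc := VWVW_comm P0 Q0 gam0 gamV gamI bicharYY bicharWY bichar_W.
have YVWc := Y_VW bicharYY bichar_W.
have gamE (i j : 'I_N) : gam i j = gamma i j by rewrite /gam !inord_val.
have PE (i : 'I_N) : P i = p i by rewrite /P inord_val.
have QE (i : 'I_N) : Q i = q i by rewrite /Q inord_val.
have [] := @Kn_lift k N p q gamma (torus_of s) Xs Ys.
- by move=> i j; rewrite -gamE; apply: (solY_solY YYc).
- by move=> i j ij; rewrite -gamE -PE; apply: (solX_solY_lt VWYc).
- by move=> i j ij; rewrite -gamE -QE; apply: (solX_solY_gt VWYc).
- by move=> i j ij; rewrite -gamE -QE -PE; apply: (solX_solX VWVWc).
- move=> i; rewrite -(@Om_sum _ Xs Ys) ?(ltnW (ltn_ord i)) // Ws_Om ?(ltnW (ltn_ord i)) //.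
  rewrite -QE; apply: (@solX_solY_eq _ P Q gam gamI _ Y W VW VWYc YVWc); exact: betaE.
move=> f [fx fy]; exists f; split=> i iN; first by rewrite /x fx inordK.
by rewrite /y fy inordK.
Qed.

(** ** Injectivity modulo the ideal *)

Lemma leads_image_y i : ~~ in_y i -> leads pos (Ys i) (eY i).
Proof.
by move=> yT; apply: leadsZ (leads_tmon _ _ _); rewrite /eta yT oner_neq0.
Qed.

(** Admissibility enters here: if neither x_i nor y_i is in T, then W_i and
    W_i.+1 do not both vanish, and the larger survivor gives the leading term. *)
Lemma leads_image_x i : (i < N)%N -> ~~ in_x i ->
  leads pos (Xs i) (eX eY eW in_Om i).
Proof.
move=> iN xT; have := admissible_in iN.
rewrite /solX /eX /alpha /beta /omega (negPf xT) !orFb.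
case: (in_y i) => [/esym/andP[_ ->]|].
  rewrite scale0r add0r; apply: leadsZ (leads_tmon _ _ _); exact: oner_neq0.
case: (in_Om i.+1) => [|_].
  rewrite andbT => <-; rewrite mul0r scale0r add0r; apply: leadsZ (leads_tmon _ _ _).
  by rewrite mulf_neq0 ?oppr_eq0 ?oner_neq0 ?invr_eq0.
apply: leads_add_lower => //; last by rewrite mulf_neq0 ?oner_neq0 ?invr_eq0.
by rewrite !eVWE opprD addrACA subrr add0r.
Qed.

Lemma leads_pow (a : torus_of s) g m : (m = 0%N \/ leads pos a g) ->
  leads pos (a ^+ m) (g *+ m).
Proof. by case=> [->|ag]; [apply: leads_tmon | apply: leadsX]. Qed.

Variable f : {lrmorphism K -> torus_of s}.
Hypothesis fx : forall i, (i < N)%N -> f (x i) = Xs i.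
Hypothesis fy : forall i, (i < N)%N -> f (y i) = Ys i.

Lemma leads_mon e : (size e <= N)%N -> normal in_x in_y in_Om e ->
  leads pos (f (mon x y e)) (lexp eY eW in_Om e).
Proof.
elim/last_ind: e => [|e [a b] IH].
  by rewrite /mon /lexp !big_ord0 rmorph1; move=> *; apply: leads_tmon.
rewrite size_rcons => eN; rewrite normal_rcons /= => /andP[nrm /and3P[xT yT _]].
rewrite mon_rcons lexp_rcons rmorphM /=; apply: leadsM => //.
  by apply: IH => //; apply: ltnW.
rewrite rmorphM !rmorphXn /= fx // fy //; apply: leadsM => //; apply: leads_pow.
  case: (boolP (in_y (size e))) yT => [_ /eqP->|yT _]; first by left.
  by right; apply: leads_image_y.
case: (boolP (in_x (size e))) xT => [_ /eqP->|xT _]; first by left.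
by right; apply: leads_image_x.
Qed.

Lemma image_Om j : (j <= N)%N -> f (Om x y P Q j) = Ws j.
Proof.
move=> jN; rewrite -Ws_Om // /Om linear_sum; apply: eq_bigr => l _.
by rewrite linearZ /= rmorphM /= fx ?fy // (leq_trans (ltn_ord l)).
Qed.

Lemma image_gen_eq0 t : T t -> f t = 0.
Proof.
move=> Tt; have [/(_ t Tt)[[[i _ E]|[i _ E]]|[i _ E]] _ _] := admT;
  rewrite -E in Tt *; rewrite -[i]inord_val.
- rewrite [LHS]fx // /solX /alpha /beta.
  by rewrite (_ : in_x i) ?scale0r ?addr0 //; apply/asboolP; rewrite inord_val.
- rewrite [LHS]fy // /solY /eta (_ : in_y i) ?scale0r //.
  by apply/asboolP; rewrite inord_val.
rewrite -Om_KOmega // image_Om // /solW /omega (_ : in_Om i.+1) ?scale0r //.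
by apply/asboolP; rewrite inord_val.
Qed.

Lemma image_ideal_eq0 a : ideal_set J a -> f a = 0.
Proof.
pose I := [set b : K | f b = 0]%classic.
have I0 : I 0 by rewrite /I /mkset linear0.
have ID u v : I u -> I v -> I (u + v).
  by rewrite /I /mkset linearD /= => -> ->; rewrite addr0.
have Il u v : I v -> I (u * v) by rewrite /I /mkset rmorphM /= => ->; rewrite mulr0.
have Ir u v : I u -> I (u * v) by rewrite /I /mkset rmorphM /= => ->; rewrite mul0r.
apply: (@ideal_gen_sub _ T (@Ideal _ I I0 ID Il Ir)) => t Tt.
exact: image_gen_eq0.
Qed.

(** An element of the kernel is, modulo the ideal, a combination of normal
    monomials whose image is zero; by independence of the images it is the
    empty one. *)
Lemma image_eq0 a : ideal_set J a <-> f a = 0.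
Proof.
split; first exact: image_ideal_eq0.
move=> fa; have [g [gs Jag]] := tower_normal_form (tower_full a).
suff g0 : g = 0 by move: Jag; rewrite g0 linear0 subr0.
apply: (@leads_free _ _ _ _ pos0 posD pos_total _
  (f \o mon x y) (lexp eY eW in_Om)).
- by move=> e /gs[eN nrm]; apply: leads_mon; rewrite ?eN.
- have half e : e \in msupp g -> forall i, (i < N)%N -> in_Om i.+1 ->
     ((nth (0, 0)%N e i).1 == 0%N) || ((nth (0, 0)%N e i).2 == 0%N).
    move=> /gs[eN /allP nrm] i iN wT.
    have := nrm i; rewrite mem_iota eN /normal_pair wT => /(_ iN)/and3P[_ _].
    by [].
  by move=> e e' ge ge'; apply: lexp_sep; [case: (gs e ge)|case: (gs e' ge')|apply: half..].
have -> : lext (f \o mon x y) g = f (lext (mon x y) g).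
  by rewrite /lext linear_sum; apply: eq_bigr => e _; rewrite linearZ.
have := image_ideal_eq0 Jag.
by rewrite linearB /= fa sub0r => /eqP; rewrite oppr_eq0 => /eqP.
Qed.

Lemma generator_x i : ideal_set J (Kx p q gamma i) -> T (Kx p q gamma i).
Proof.
move=> /image_eq0; rewrite -[i]inord_val => fi; apply: contrapT => nT.
have := leads_neq0 (leads_image_x (ltn_ord i) (introN (asboolP _) nT)).
by rewrite -fx.
Qed.

Lemma generator_y i : ideal_set J (Ky p q gamma i) -> T (Ky p q gamma i).
Proof.
move=> /image_eq0; rewrite -[i]inord_val => fi; apply: contrapT => nT.
have := leads_neq0 (leads_image_y (introN (asboolP _) nT)).
by rewrite -fy.
Qed.

Lemma generator_Om i : ideal_set J (KOmega p q gamma i) -> T (KOmega p q gamma i).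
Proof.
move=> /image_eq0; rewrite -[i]inord_val -Om_KOmega // image_Om // => fi.
apply: contrapT; rewrite Om_KOmega // => nT; move: fi; rewrite /solW /omega.
rewrite (_ : in_Om i.+1 = false); last exact/asboolPn.
by apply: leads_neq0; apply: leadsZ (leads_tmon s pos _); apply: oner_neq0.
Qed.

Lemma admissible_ideal :
  [/\ (J `&` calP p q gamma)%classic = T, completely_prime J & Hprime J].
Proof.
have [TP _ _] := admT.
have cpJ : completely_prime J.
  apply: (@kernel_completely_prime _ _ _ _ _ _ f); last exact: image_eq0.
  exact: (torus_domain pos0 posD pos_total).
split=> //.
  apply/seteqP; split=> [t [Jt]|t Tt]; last first.
    by split; [apply: sub_ideal_gen | apply: TP].
  case=> [[[i _ E]|[i _ E]]|[i _ E]]; rewrite -E in Jt *.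
  - exact: generator_x.
  - exact: generator_y.
  - exact: generator_Om.
apply: completely_prime_Hprime => //; apply: ideal_gen_eigen_stable => t Tt h.
exact/calP_eigen/TP.
Qed.

End AdmissibleIdeal.


Local Open Scope classical_set_scope.

Theorem theorem2p8 (k : fieldType) (n : nat) (p q : 'I_n -> k)
    (gamma : 'M[k]_n) (T : set (Kn p q gamma)) :
  (1 <= n)%N ->
  (forall i, p i != 0) ->
  (forall i, q i != 0) ->
  (forall i, p i != q i) ->
  (forall i j, gamma i j != 0) ->
  (forall i j, gamma j i = (gamma i j)^-1) ->
  (forall i, gamma i i = 1) ->
  (forall i (m : nat), (0 < m)%N -> (p i * (q i)^-1) ^+ m != 1) ->
  admissible T ->
  [/\ ideal_gen T `&` calP p q gamma = T,
      completely_prime (ideal_gen T)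
    & Hprime (ideal_gen T)].
Proof.
case: n p q gamma T => // n p q gamma T _ p0 q0 pq gam0 gamV gamI _ admT.
pose P i := p (inord i); pose Q i := q (inord i).
pose gam i j := gamma (inord i) (inord j).
have MY0 : forall i j, MY gam i j != 0 by apply: MY_neq0 => i j; apply: gam0.
have MW0 : forall j i, MW P Q j i != 0.
  by apply: MW_neq0 => i; [apply: p0 | apply: q0].
have sYY := bicharYY MY0 MW0; have sWY := bicharWY MY0 MW0.
have s_W := bichar_W MY0 MW0.
have [f [fx fy]] := torus_representation p0 q0 pq gam0 gamV gamI admT sYY sWY s_W.
apply: (admissible_ideal p0 q0 pq gam0 gamV admT sYY s_W exps_pos0
  exps_posD exps_pos_total exps_posWW _ fx fy).
by move=> e e' eN e'N oke oke'; apply: (lexp_inj eN e'N).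
Qed.
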